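(* Let $f$ be a meromorphic function on $\mathbb C^*$, holomorphic near $1$, which is odd, $f(x^{-1})=-f(x)$, and has a simple zero at $x=1$: $f(1)=0$, $f^{(1)}(1)\neq0$. Let $n\ge2$ and let the variables satisfy $t_1\cdots t_n=1$. Then $\Phi(t_1,\ldots,t_n)\to0$ as $t_1\to1$.
   Context: $f^{(k)}(x):=(x\frac{d}{dx})^kf(x)$. $\Gamma_n$ is the set of compositions of $\{1,\ldots,n\}$: ordered tuples $\gamma=(\gamma_1,\ldots,\gamma_\ell)$ of nonempty pairwise disjoint subsets with union $\{1,\ldots,n\}$, $\ell(\gamma)=\ell$; put $\upsilon(\gamma)_i=\gamma_1\cup\cdots\cup\gamma_{i-1}$. Define $$\Phi(t_1,\ldots,t_n)=\sum_{\gamma\in\Gamma_n}(-1)^{\ell(\gamma)}f^{(\#\gamma_1)}(1)\prod_{i=2}^{\ell(\gamma)}\frac{f^{(\#\gamma_i)}\big(\prod_{j\in\upsilon(\gamma)_i}t_j\big)}{f\big(\prod_{j\in\upsilon(\gamma)_i}t_j\big)}.$$ *)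

(* Defs.v *)
From mathcomp Require Import all_boot all_order all_algebra.
From mathcomp Require Import complex.
From mathcomp Require Import all_classical all_reals topology normedtype derive.
Set Implicit Arguments. Unset Strict Implicit. Unset Printing Implicit Defensive.
Import Order.TTheory GRing.Theory Num.Theory.
Local Open Scope ring_scope.
Local Open Scope complex_scope.
Local Open Scope ring_scope.

(* The complex numbers, built over a real field R, seen as a normed space over
   themselves (so that [derive1] is the complex derivative). *)
Notation Cplx R := ((R[i])^o).

Section Defs.
Variable R : realType.

Definition holo_near (f : Cplx R -> Cplx R) (a : Cplx R) : Prop :=
  \forall z \near a, derivable f z 1.

(* f is meromorphic on C^* : near every a <> 0, f coincides (off a) with
   g z / (z - a)^m for some g holomorphic near a and some order m.
   (Values of f at the poles themselves are irrelevant.) *)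
Definition meromorphic_Cstar (f : Cplx R -> Cplx R) : Prop :=
  forall a : Cplx R, a != 0 ->
    exists (m : nat) (g : Cplx R -> Cplx R),
      holo_near g a /\
      \forall z \near a, z != a -> f z = g z / (z - a) ^+ m.

Definition euler_op (f : Cplx R -> Cplx R) : Cplx R -> Cplx R :=
  fun x => x * derive1 f x.

Definition theta_pow (k : nat) (f : Cplx R -> Cplx R) : Cplx R -> Cplx R :=
  iter k euler_op f.

(* Compositions of {0,..,n-1} (0-based version of {1,..,n}) with l.+1 blocks:
   ordered tuples of nonempty pairwise disjoint subsets covering everything. *)
Definition is_composition (n l : nat) (g : {ffun 'I_l.+1 -> {set 'I_n}}) : bool :=
  [forall i, g i != finset.set0] &&
  [forall i, forall j, (i != j) ==> [disjoint g i & g j]] &&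
  (\bigcup_(i < l.+1) g i == [set: 'I_n]).

Definition upsilon (n l : nat) (g : {ffun 'I_l.+1 -> {set 'I_n}}) (i : 'I_l.+1)
  : {set 'I_n} := \bigcup_(k < l.+1 | (k < i)%N) g k.

Definition Phi (f : Cplx R -> Cplx R) (n : nat) (t : 'I_n -> Cplx R) : Cplx R :=
  \sum_(l < n)
   \sum_(g : {ffun 'I_l.+1 -> {set 'I_n}} | is_composition g)
     (-1) ^+ l.+1 * theta_pow #|g ord0| f 1 *
     \prod_(i < l.+1 | (0 < i)%N)
        (theta_pow #|g i| f (\prod_(j in upsilon g i) t j) /
         f (\prod_(j in upsilon g i) t j)).

(* Path on the torus t_1 ... t_n = 1 through the point s (with s_1 = 1):
   t_1 = x, t_j = s_j for 1 < j < n, and t_n = s_n / x. *)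
Definition tpath (n : nat) (s : 'I_n -> Cplx R) (x : Cplx R) : 'I_n -> Cplx R :=
  fun j => if val j == 0%N then x
           else if val j == n.-1 then s j / x else s j.

End Defs.

(* Main.v *)
Require Import Defs.
From mathcomp Require Import all_boot all_order all_algebra.
From mathcomp Require Import complex ring lra.
From mathcomp Require Import all_classical all_reals topology normedtype derive.
From mathcomp Require Import measure lebesgue_measure lebesgue_integral ftc.

(** Summing over the first block exhibits [Phi] as a recursion over the set [U] of
    indices already used, each block contributing a factor [- f^(k)(t_U) / f(t_U)].
    As [t_1 -> 1] the only singular factors are those with [U = {1}], where
    [t_U = t_1], and with [U = {2, .., n}], where [t_U = 1 / t_1].  Grouping the
    terms by the trace [B] on [{2, .., n}] of the first block that meets it, the
    coefficients of the two poles are regular functions [P_B] (1 already used) and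
    [Q_B] (1 not yet used) which agree at [t_1 = 1].  Oddness gives
    [f^(1)/f (1/x) = - f^(1)/f (x)] and [f^(2)(1) = 0], so the poles cancel and leave
    [f^(#B+1)(1) P_B + f^(#B)(1) (P_B' - Q_B')].  The identity
    [x (f^(k)/f)' = f^(k+1)/f - (f^(1)/f) (f^(k)/f)] turns [P_B' - Q_B'] into the
    regular part [R_B] of the sum of the orders in which 1 comes after [B], and
    everything cancels.

    The regularity of the iterated derivatives rests on Cauchy's formula on a square:
    Goursat's bisection argument gives
    [f(w) * int dz/(z-w) = int f(z) dz/(z-w)], whose two integrals are twice
    differentiable in [w]. *)

Set Implicit Arguments. Unset Strict Implicit. Unset Printing Implicit Defensive.
Import Normc Order.TTheory GRing.Theory Num.Theory.
Import numFieldNormedType.Exports.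
Local Open Scope ring_scope.
Local Open Scope complex_scope.
Local Open Scope ring_scope.

(** The hypotheses give only derivability near a point, whereas [theta_pow] iterates [derive1],
    which carries meaning only where its argument is derivable. Derivability must therefore be
    proved for the derivative; once is enough, since being [holo_near] a point is then inherited by
    every iterate. Cauchy's formula is kept as a quotient of two contour integrals, which avoids the
    value 2 pi i: the denominator only has to be nonzero at the centre.

    The last relation passes through a block because P evaluates f^(k)/f at t_1 t_U where Q
    evaluates it at t_U: differentiating in t_1 at 1, the two differ by exactly one x d/dx.

    The two poles are then put over the single denominator f(t_1). The numerator vanishes at 1
    because P = Q there, and the simple zero of f lets l'Hopital's rule give the finite part. *)

Local Notation Re := complex.Re.
Local Notation Im := complex.Im.

(** * Complex limits and derivatives in terms of the real modulus *)

Section ComplexBridge.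
Variable R : realType.
Implicit Types (z w : R[i]).

Lemma normrC z : `|z| = (normc z)%:C.
Proof. by []. Qed.

Lemma normc_ge0 z : 0 <= normc z.
Proof. by case: z => a b; exact: sqrtr_ge0. Qed.

Lemma normc_gt0 z : (0 < normc z) = (z != 0).
Proof.
rewrite lt_def normc_ge0 andbT; congr (~~ _); apply/eqP/eqP => [/eq0_normc //|->].
exact: normc0.
Qed.

Lemma normc_real (x : R) : normc x%:C = `|x|.
Proof. by rewrite /= expr0n /= addr0 sqrtr_sqr. Qed.

Lemma normc_imag (x : R) : normc (0 +i* x) = `|x|.
Proof. by rewrite /= expr0n /= add0r sqrtr_sqr. Qed.

Lemma Re_le_normc z : `|Re z| <= normc z.
Proof.
case: z => a b /=; rewrite -sqrtr_sqr ler_sqrt ?lerDl ?sqr_ge0 //.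
by rewrite addr_ge0 ?sqr_ge0.
Qed.

Lemma Im_le_normc z : `|Im z| <= normc z.
Proof.
case: z => a b /=; rewrite -sqrtr_sqr ler_sqrt ?lerDr ?sqr_ge0 //.
by rewrite addr_ge0 ?sqr_ge0.
Qed.

Lemma normc_le_ReIm z : normc z <= `|Re z| + `|Im z|.
Proof.
have -> : z = (Re z)%:C + (0 +i* Im z).
  by case: z => a b; apply/eqP; rewrite eq_complex /= addr0 add0r !eqxx.
apply: (le_trans (le_normcD _ _)).
by rewrite normc_real normc_imag /= addr0 add0r.
Qed.

Lemma normcB z w : normc (z - w) = normc (w - z).
Proof. by rewrite -normcN opprB. Qed.

Lemma normc_tri z w : normc (z - w) <= normc z + normc w.
Proof. by apply: (le_trans (le_normcD _ _)); rewrite normcN. Qed.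

Lemma normc_trib z w : normc z - normc w <= normc (z - w).
Proof. by rewrite lerBlDr; apply: le_trans (le_normcD _ _); rewrite subrK. Qed.

(** A positive element of [R[i]] has zero imaginary part, so every radius in [R[i]] is real and
    neighbourhoods can be tested with [normc]. *)
Lemma nearC (a : Cplx R) (P : Cplx R -> Prop) :
  (\forall z \near a, P z)%classic <->
  exists2 d : R, 0 < d & forall z : R[i], normc (z - a) < d -> P z.
Proof.
split=> [/nbhs_ballP[e /= e0 He]|[d d0 Hd]].
  case: e e0 He => d i e0 He; move: e0; rewrite ltcE /= => /andP[/eqP i0 d0].
  exists d => // z zd; apply: He; rewrite -ball_normE /ball_ /=.
  rewrite distrC normrC ltcE /= i0 eqxx /=; exact: zd.
apply/nbhs_ballP; exists d%:C; first by rewrite /= ltcR.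
move=> z; rewrite -ball_normE /ball_ /= distrC normrC ltcR; exact: Hd.
Qed.

Lemma cvgC (T : Type) (F : set_system T) {FF : Filter F} (f : T -> Cplx R) (l : Cplx R) :
  (f @ F --> l)%classic <->
  (forall e : R, 0 < e -> \forall x \near F, normc (f x - l) < e).
Proof.
split=> [/cvgrPdist_lt H e e0|H].
  have : (0 : R[i]) < e%:C by rewrite ltcR.
  move=> /H; apply: filterS => x; rewrite distrC normrC ltcR; exact.
apply/cvgrPdist_lt => e e0; move: (e0); rewrite ltcE /= => /andP[/eqP i0 d0].
move: (H _ d0); apply: filterS => x xd.
by rewrite distrC normrC ltcE /= i0 eqxx.
Qed.

Lemma continuousC (f : Cplx R -> Cplx R) (a : Cplx R) : {for a, continuous f} <->
  forall e : R, 0 < e -> exists2 d : R, 0 < d &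
    forall z : R[i], normc (z - a) < d -> normc (f z - f a) < e.
Proof.
split=> [/cvgC H e e0|H]; first by move/nearC: (H e e0).
by apply: (@cvgC _ (nbhs a) _ f (f a)).2 => e /H ?; apply/nearC.
Qed.

Lemma Re_cvg (T : Type) (F : set_system T) {FF : Filter F} (f : T -> Cplx R) (l : Cplx R) :
  (f @ F --> l -> (fun x => Re (f x)) @ F --> Re l)%classic.
Proof.
move/cvgC => H; apply/cvgrPdist_lt => e e0; move: (H e e0); apply: filterS => x.
by apply: le_lt_trans; rewrite distrC -raddfB; exact: Re_le_normc.
Qed.

Lemma Im_cvg (T : Type) (F : set_system T) {FF : Filter F} (f : T -> Cplx R) (l : Cplx R) :
  (f @ F --> l -> (fun x => Im (f x)) @ F --> Im l)%classic.
Proof.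
move/cvgC => H; apply/cvgrPdist_lt => e e0; move: (H e e0); apply: filterS => x.
by apply: le_lt_trans; rewrite distrC -raddfB; exact: Im_le_normc.
Qed.

Lemma ReIm_cvg (T : Type) (F : set_system T) {FF : Filter F} (u v : T -> R) (a b : R) :
  (u @ F --> a -> v @ F --> b -> (fun x => u x +i* v x : Cplx R) @ F --> (a +i* b : Cplx R))%classic.
Proof.
move=> /cvgrPdist_lt Hu /cvgrPdist_lt Hv; apply/cvgC => e e0.
have e20 : 0 < e / 2 by lra.
near=> x.
apply: (le_lt_trans (normc_le_ReIm _)) => /=.
rewrite [ltRHS](splitr e) ltrD //.
  by rewrite distrC; near: x; exact: Hu.
by rewrite distrC; near: x; exact: Hv.
Unshelve. all: by end_near. Qed.

(** The increment is multiplied out: [h = 0] is no exception, and the inequality is the one that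
    contour estimates deliver. *)
Definition cdiff (f : R[i] -> R[i]) (z l : R[i]) :=
  forall e : R, 0 < e -> exists2 d : R, 0 < d &
    forall h, normc h < d -> normc (f (z + h) - f z - l * h) <= e * normc h.

Lemma is_derive_cdiff (f : Cplx R -> Cplx R) (z l : Cplx R) :
  is_derive z (1 : Cplx R) f l <-> cdiff f z l.
Proof.
split=> [[fd fl] e e0|H].
  move: fd; rewrite /derivable; set g := fun h => _; move=> fd.
  have /cvgC /(_ _ e0) : (g @ 0^' --> l)%classic by rewrite -fl; exact: fd.
  rewrite near_withinE => /nearC[d d0 Hd]; exists d => // h hd.
  have [->|h0] := eqVneq h 0.
    by rewrite addr0 mulr0 subr0 subrr normc0 mulr0.
  have := Hd h; rewrite subr0 => /(_ hd h0) /ltW.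
  rewrite /g /= => H.
  have -> : f (z + h) - f z - l * h = (h^-1 *: (f (h *: 1 + z) - f z) - l) * h.
    rewrite -[h *: _]/(h * 1) -[h^-1 *: _]/(h^-1 * _) mulr1 mulrBl.
    by rewrite [h^-1 * _]mulrC mulfVK // [h + z]addrC.
  by rewrite normcM ler_wpM2r // normc_ge0.
have L : ((fun h : Cplx R => h^-1 *: ((f \o shift z) (h *: (1 : Cplx R)) - f z)) @ 0^' --> l)%classic.
  apply/cvgC => e e0; rewrite near_withinE; apply/nearC.
  have e20 : 0 < e / 2 by lra.
  have [d d0 Hd] := H _ e20; exists d => // h; rewrite subr0 => hd h0.
  have nh : 0 < normc h by rewrite normc_gt0.
  rewrite -(ltr_pM2r nh) -normcM.
  apply: (@le_lt_trans _ _ (e / 2 * normc h)); last by rewrite ltr_pM2r //; lra.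
  apply: le_trans (Hd h hd); rewrite le_eqVlt; apply/orP; left; apply/eqP; congr normc.
  rewrite /= -[h *: _]/(h * 1) -[h^-1 *: _]/(h^-1 * _) mulr1 mulrBl.
  by rewrite [h^-1 * _]mulrC mulfVK // [h + z]addrC.
split; last by apply: cvg_lim.
by apply/cvg_ex; exists l.
Qed.

Lemma cdiff_derivable (f : Cplx R -> Cplx R) (z l : Cplx R) : cdiff f z l -> derivable f z 1.
Proof. by move=> /is_derive_cdiff []. Qed.

Lemma derivable_cdiff (f : Cplx R -> Cplx R) (z : Cplx R) :
  derivable f z 1 -> cdiff f z (f^`() z)%classic.
Proof. by move=> fd; apply/is_derive_cdiff; rewrite derive1E; apply/derivableP. Qed.

End ComplexBridge.

(** * Primitives and integrals of complex functions of a real variable *)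

Section Primitives.
Variables (R : realType) (A : R).
Implicit Types (u v : R -> R) (phi psi : R -> Cplx R).

Lemma primitive_exists u : continuous u ->
  exists U : R -> R, forall x, A < x -> is_derive x (1 : R) U (u x).
Proof.
move=> cu; exists (fun x => (\int[@lebesgue_measure R]_(t in `[A, x]) u t)%R) => x Ax.
have xx1 : x < x + 1 by rewrite ltrDl.
have int : (@lebesgue_measure R).-integrable `[A, x + 1]%classic (EFin \o u).
  apply: continuous_compact_integrable; first exact: segment_compact.
  by apply: continuous_subspaceT.
have [d e] := continuous_FTC1_closed xx1 int Ax (cu x).
by move: e; rewrite derive1E; exact: DeriveDef.
Qed.

Lemma primitive_bound U u a b M : (forall x, A < x -> is_derive x (1 : R) U (u x)) ->
  A < a -> a <= b -> (forall x, a <= x -> x <= b -> `|u x| <= M) ->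
  `|U b - U a| <= M * (b - a).
Proof.
move=> dU Aa ab Mu.
have [||c /itvP cab ->] := @MVT_segment R U u a b ab.
- by move=> x /itvP xab; apply: dU; apply: (lt_le_trans Aa); rewrite xab.
- apply: continuous_in_subspaceT => x /set_mem /= /itvP xab.
  have [|d _] := dU x; first by apply: (lt_le_trans Aa); rewrite xab.
  by apply: differentiable_continuous; apply/derivable1_diffP.
rewrite normrM [`|b - a|]ger0_norm ?subr_ge0 // ler_wpM2r ?subr_ge0 //.
by apply: Mu; rewrite cab.
Qed.

(* The integral over [[A, x]] is a primitive of its integrand on [x > A] only, hence
   the left end [A] kept strictly below all contours. *)
Definition is_prim phi (Phi : R -> R[i]) := forall x, A < x ->
  is_derive x (1 : R) (fun t => Re (Phi t)) (Re (phi x)) /\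
  is_derive x (1 : R) (fun t => Im (Phi t)) (Im (phi x)).

Lemma is_prim_exists phi : continuous phi -> exists Phi, is_prim phi Phi.
Proof.
move=> cp.
have [|U HU] := @primitive_exists (fun x => Re (phi x)).
  by move=> x; apply: Re_cvg; exact: cp.
have [|V HV] := @primitive_exists (fun x => Im (phi x)).
  by move=> x; apply: Im_cvg; exact: cp.
by exists (fun x => U x +i* V x) => x Ax; split; [exact: HU|exact: HV].
Qed.

(** The mean value theorem is applied to real and imaginary parts separately, whence the factor
    2. *)
Lemma is_prim_bound phi Phi a b M : is_prim phi Phi ->
  A < a -> a <= b -> (forall x, a <= x -> x <= b -> normc (phi x) <= M) ->
  normc (Phi b - Phi a) <= 2 * M * (b - a).
Proof.
move=> pP Aa ab HM.
have H1 : `|Re (Phi b) - Re (Phi a)| <= M * (b - a).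
  apply: (primitive_bound (fun x Ax => (pP x Ax).1)) => // x xa xb.
  exact: le_trans (Re_le_normc _) (HM _ xa xb).
have H2 : `|Im (Phi b) - Im (Phi a)| <= M * (b - a).
  apply: (primitive_bound (fun x Ax => (pP x Ax).2)) => // x xa xb.
  exact: le_trans (Im_le_normc _) (HM _ xa xb).
apply: (le_trans (normc_le_ReIm _)); rewrite !raddfB /=; lra.
Qed.

Lemma is_primD phi psi Phi Psi : is_prim phi Phi -> is_prim psi Psi ->
  is_prim (fun x => phi x + psi x) (fun x => Phi x + Psi x).
Proof.
move=> p q x Ax; have [p1 p2] := p x Ax; have [q1 q2] := q x Ax.
split; rewrite raddfD /=; (under eq_fun do rewrite raddfD /=); exact: is_deriveD.
Qed.

Lemma is_primZ (k : R[i]) phi Phi : is_prim phi Phi ->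
  is_prim (fun x => k * phi x) (fun x => k * Phi x).
Proof.
case: k => a b p x Ax; have [p1 p2] := p x Ax.
have ReM : forall z, Re ((a +i* b) * z) = a * Re z - b * Im z by case.
have ImM : forall z, Im ((a +i* b) * z) = a * Im z + b * Re z by case.
split; rewrite ?ReM ?ImM.
  rewrite (_ : (fun t => Re _) = (a \*: (fun t => Re (Phi t))) - (b \*: (fun t => Im (Phi t)))).
    exact: is_deriveB.
  by apply/funext => t; rewrite ReM.
rewrite (_ : (fun t => Im _) = (a \*: (fun t => Im (Phi t))) + (b \*: (fun t => Re (Phi t)))).
  exact: is_deriveD.
by apply/funext => t; rewrite ImM.
Qed.

Lemma is_prim_cst (k : R[i]) : is_prim (fun=> k) (fun x => k * x%:C).
Proof.
move=> x Ax; case: k => a b /=; split.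
  rewrite (_ : (fun t => _) = a \*: (@id R)); last first.
    by apply/funext => t; rewrite mulr0 subr0.
  by apply: is_derive_eq; rewrite /GRing.scale /= mulr1.
rewrite (_ : (fun t => _) = b \*: (@id R)); last first.
  by apply/funext => t; rewrite mulr0 add0r.
by apply: is_derive_eq; rewrite /GRing.scale /= mulr1.
Qed.

Lemma is_prim_id : is_prim (fun x => x%:C) (fun x => (x ^+ 2 / 2)%:C).
Proof.
move=> x Ax /=; split; last exact: is_derive_cst.
rewrite (_ : (fun t => _) = (2^-1) \*: ((@id R) ^+ 2)); last first.
  by apply/funext => t; rewrite /= /GRing.scale /= mulrC.
by apply: is_derive_eq; rewrite /GRing.scale /= expr1 mulr1; field.
Qed.

Definition prim_of phi : R -> R[i] := xget (fun=> 0) (is_prim phi).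

Lemma prim_ofP phi : continuous phi -> is_prim phi (prim_of phi).
Proof. by move=> /is_prim_exists [P HP]; rewrite /prim_of; case: xgetP => [//|/(_ P)]. Qed.

(** A difference of values of one chosen primitive: cutting the interval is formal telescoping, and
    linearity follows from the uniqueness in [cint_prim]. *)
Definition cint phi a b := prim_of phi b - prim_of phi a.

(** The difference of two primitives is a primitive of 0, so [is_prim_bound] with bound 0 makes it
    constant. *)
Lemma cint_prim phi Phi a b : continuous phi -> is_prim phi Phi ->
  A < a -> a <= b -> cint phi a b = Phi b - Phi a.
Proof.
move=> cp pP Aa ab.
have H := @is_prim_bound _ _ a b 0 (is_primD (prim_ofP cp) (is_primZ (-1) pP)) Aa ab.
have : normc (prim_of phi b + -1 * Phi b - (prim_of phi a + -1 * Phi a)) <= 0.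
  apply: (le_trans (H _)); last by rewrite mulr0 mul0r.
  by move=> x _ _; rewrite mulN1r subrr normc0.
rewrite le_eqVlt ltNge normc_ge0 orbF => /eqP /eq0_normc /eqP.
rewrite !mulN1r subr_eq0 => /eqP E.
by rewrite /cint -[X in X - _](subrK (Phi b)) E; ring.
Qed.

Lemma cintD phi psi a b : continuous phi -> continuous psi ->
  A < a -> a <= b ->
  cint (fun x => phi x + psi x) a b = cint phi a b + cint psi a b.
Proof.
move=> cp cq Aa ab.
have cpq : continuous (fun x => phi x + psi x : Cplx R).
  by move=> x; apply: cvgD; [exact: cp|exact: cq].
rewrite (cint_prim cpq (is_primD (prim_ofP cp) (prim_ofP cq)) Aa ab).
by rewrite /cint opprD addrACA.
Qed.

Lemma cintZ k phi a b : continuous phi -> A < a -> a <= b ->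
  cint (fun x => k * phi x) a b = k * cint phi a b.
Proof.
move=> cp Aa ab.
have ckp : continuous (fun x => k * phi x : Cplx R).
  by move=> x; apply: cvgM; [exact: cvg_cst|exact: cp].
by rewrite (cint_prim ckp (is_primZ k (prim_ofP cp)) Aa ab) /cint mulrBr.
Qed.

Lemma cint_bound phi a b M : continuous phi -> A < a -> a <= b ->
  (forall x, a <= x -> x <= b -> normc (phi x) <= M) ->
  normc (cint phi a b) <= 2 * M * (b - a).
Proof. by move=> cp; apply: is_prim_bound; exact: prim_ofP. Qed.

Lemma cint_split phi a m b : cint phi a m + cint phi m b = cint phi a b.
Proof. by rewrite /cint addrC subrKA. Qed.

End Primitives.

(** * Nested rectangles *)

Section Bisection.
Variable R : realType.
Implicit Types (a b c d : R).

Lemma nested_intervals (a b : nat -> R) : (forall k, a k <= a k.+1) ->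
  (forall k, b k.+1 <= b k) -> (forall k, a k <= b k) ->
  exists p, forall k, a k <= p <= b k.
Proof.
move=> ha hb hab.
have am : {homo a : m n / (m <= n)%N >-> m <= n} by apply: homo_leq => //; exact: le_trans.
have bm : {homo b : m n / (m <= n)%N >-> n <= m}.
  by apply: homo_leq => // x y z xy yz; exact: le_trans yz xy.
have ub k : ubound (range a) (b k).
  move=> _ [m _ <-]; have [mk|km] := leqP m k; first exact: le_trans (am _ _ mk) (hab _).
  exact: le_trans (hab _) (bm _ _ (ltnW km)).
exists (sup (range a)) => k; apply/andP; split.
  by apply: ub_le_sup; [exists (b 0%N); exact: ub|exists k].
by apply: ge_sup; [exists (a 0%N), 0%N|exact: ub].
Qed.

(** If [P] failed, choosing a failing quarter again and again would give failing rectangles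
    shrinking to a point [(p, q)], against the local hypothesis there. That point may lie on their
    boundaries, hence the weak inequalities. *)
Lemma rectangle_bisection (P : R -> R -> R -> R -> Prop) (a0 b0 c0 d0 : R) :
  a0 <= b0 -> c0 <= d0 ->
  (forall a b c d, a0 <= a -> a <= b -> b <= b0 -> c0 <= c -> c <= d -> d <= d0 ->
     P a ((a + b) / 2) c ((c + d) / 2) -> P ((a + b) / 2) b c ((c + d) / 2) ->
     P a ((a + b) / 2) ((c + d) / 2) d -> P ((a + b) / 2) b ((c + d) / 2) d ->
     P a b c d) ->
  (forall p q, a0 <= p <= b0 -> c0 <= q <= d0 ->
     exists2 e : R, 0 < e & forall a b c d, a0 <= a -> b <= b0 -> c0 <= c -> d <= d0 ->
       a <= p <= b -> c <= q <= d -> b - a < e -> d - c < e -> P a b c d) ->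
  P a0 b0 c0 d0.
Proof.
move=> ab0 cd0 Pstep Ploc; apply: contrapT => nP0.
pose A (r : R * R * R * R) := r.1.1.1; pose B (r : R * R * R * R) := r.1.1.2.
pose C (r : R * R * R * R) := r.1.2; pose D (r : R * R * R * R) := r.2.
pose bad r := [/\ a0 <= A r, A r <= B r, B r <= b0 & [/\ c0 <= C r, C r <= D r, D r <= d0 &
   ~ P (A r) (B r) (C r) (D r)]].
pose sub r r' := [/\ bad r', A r <= A r' /\ B r' <= B r, C r <= C r' /\ D r' <= D r,
   B r' - A r' = (B r - A r) / 2 & D r' - C r' = (D r - C r) / 2].
have step r : bad r -> exists r', sub r r'.
  case: r => [[[a b] c] d]; rewrite /sub /bad /A /B /C /D /=.
  move=> [aa ab bb [cc cd dd nP]]; apply: contrapT => nE; apply: nP.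
  apply: Pstep => //; apply: contrapT => nP; apply: nE.
  - by exists (a, (a + b) / 2, c, (c + d) / 2) => /=; do !split => //; lra.
  - by exists ((a + b) / 2, b, c, (c + d) / 2) => /=; do !split => //; lra.
  - by exists (a, (a + b) / 2, (c + d) / 2, d) => /=; do !split => //; lra.
  - by exists ((a + b) / 2, b, (c + d) / 2, d) => /=; do !split => //; lra.
pose next r := xget r (sub r).
have nextP r : bad r -> sub r (next r).
  by move=> /step [r' Hr']; rewrite /next; case: xgetP => [//|/(_ r')].
pose s k := iter k next (a0, b0, c0, d0).
have badS k : bad (s k).
  by elim: k => [|k IH]; [rewrite /bad /A /B /C /D /= !lexx; do !split|case: (nextP _ IH)].
have subS k : sub (s k) (s k.+1) by exact: nextP.
have [p Hp] : exists p, forall k, A (s k) <= p <= B (s k).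
  apply: nested_intervals => k; first by case: (subS k) => _ [].
    by case: (subS k) => _ [].
  by case: (badS k).
have [q Hq] : exists p, forall k, C (s k) <= p <= D (s k).
  apply: nested_intervals => k; first by case: (subS k) => _ _ [].
    by case: (subS k) => _ _ [].
  by case: (badS k) => _ _ _ [].
have szAB k : B (s k) - A (s k) = (b0 - a0) / 2 ^+ k.
  elim: k => [|k IH]; first by rewrite /A /B /= expr0 divr1.
  by case: (subS k) => _ _ _ -> _; rewrite IH exprS invfM mulrAC mulrA.
have szCD k : D (s k) - C (s k) = (d0 - c0) / 2 ^+ k.
  elim: k => [|k IH]; first by rewrite /C /D /= expr0 divr1.
  by case: (subS k) => _ _ _ _ ->; rewrite IH exprS invfM mulrAC mulrA.
have [e e0 He] := Ploc p q (Hp 0%N) (Hq 0%N).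
have small x : exists k, x / 2 ^+ k < e :> R.
  exists (Num.truncn `|x / e|).+1.
  rewrite ltr_pdivrMr ?exprn_gt0 // mulrC -ltr_pdivrMr //.
  apply: (le_lt_trans (ler_norm _)).
  apply: (lt_trans (truncnS_gt _)).
  by rewrite -natrX ltr_nat ltn_expl.
have [k1 Hk1] := small (b0 - a0); have [k2 Hk2] := small (d0 - c0).
pose k := maxn k1 k2.
have mono x m : 0 <= x -> (m <= k)%N -> x / 2 ^+ m < e -> x / 2 ^+ k < e.
  move=> x0 mk; apply: le_lt_trans; rewrite ler_wpM2l // lef_pV2 ?posrE ?exprn_gt0 //.
  by rewrite -!natrX ler_nat leq_exp2l.
case: (badS k) => h1 h2 h3 [h4 h5 h6]; apply; apply: He => //.
  by rewrite szAB; apply: (mono _ k1) => //; rewrite ?subr_ge0 // leq_maxl.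
by rewrite szCD; apply: (mono _ k2) => //; rewrite ?subr_ge0 // leq_maxr.
Qed.

End Bisection.

(** * Integrals along the boundary of a rectangle *)

Section RectangleIntegral.
Variables (R : realType) (A : R).
Implicit Types (g h : Cplx R -> Cplx R) (a b c d : R).

Local Notation ii := (0 +i* 1 : R[i]).

Definition rint g a b c d : R[i] :=
  cint A (fun x => g (x +i* c)) a b + ii * cint A (fun y => g (b +i* y)) c d
  - cint A (fun x => g (x +i* d)) a b - ii * cint A (fun y => g (a +i* y)) c d.

Definition edge a b c d (z : R[i]) := (a <= Re z <= b) && (c <= Im z <= d) &&
  [|| Re z == a, Re z == b, Im z == c | Im z == d].

(** Continuity is asked along the four full lines carrying the sides, because the rules for [cint]
    take integrands continuous on all of [R]. *)
Definition edge_continuous g a b c d :=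
  [/\ continuous (fun x : R => g (x +i* c)), continuous (fun x : R => g (x +i* d)),
      continuous (fun y : R => g (a +i* y)) & continuous (fun y : R => g (b +i* y))].

Lemma continuous_hline (c : R) : continuous (fun x : R => x +i* c : Cplx R).
Proof. by move=> x; apply: ReIm_cvg; [exact: cvg_id|exact: cvg_cst]. Qed.

Lemma continuous_vline (c : R) : continuous (fun x : R => c +i* x : Cplx R).
Proof. by move=> x; apply: ReIm_cvg; [exact: cvg_cst|exact: cvg_id]. Qed.

Lemma continuous_edge g a b c d : continuous g -> edge_continuous g a b c d.
Proof.
move=> cg; split=> x.
- exact: (continuous_comp (@continuous_hline c x) (cg _)).
- exact: (continuous_comp (@continuous_hline d x) (cg _)).
- exact: (continuous_comp (@continuous_vline a x) (cg _)).
- exact: (continuous_comp (@continuous_vline b x) (cg _)).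
Qed.

Lemma edge_continuousD g h a b c d : edge_continuous g a b c d ->
  edge_continuous h a b c d -> edge_continuous (fun z => g z + h z) a b c d.
Proof.
case=> g1 g2 g3 g4 [h1 h2 h3 h4]; split=> x.
- exact: cvgD (g1 x) (h1 x).
- exact: cvgD (g2 x) (h2 x).
- exact: cvgD (g3 x) (h3 x).
- exact: cvgD (g4 x) (h4 x).
Qed.

Lemma edge_continuousM g h a b c d : edge_continuous g a b c d ->
  edge_continuous h a b c d -> edge_continuous (fun z => g z * h z) a b c d.
Proof.
case=> g1 g2 g3 g4 [h1 h2 h3 h4]; split=> x.
- exact: cvgM (g1 x) (h1 x).
- exact: cvgM (g2 x) (h2 x).
- exact: cvgM (g3 x) (h3 x).
- exact: cvgM (g4 x) (h4 x).
Qed.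

Lemma rintD g h a b c d : edge_continuous g a b c d -> edge_continuous h a b c d ->
  A < a -> a <= b -> A < c -> c <= d ->
  rint (fun z => g z + h z) a b c d = rint g a b c d + rint h a b c d.
Proof.
case=> g1 g2 g3 g4 [h1 h2 h3 h4] Aa ab Ac cd; rewrite /rint.
rewrite (cintD g1 h1 Aa ab) (cintD g2 h2 Aa ab) (cintD g3 h3 Ac cd) (cintD g4 h4 Ac cd).
by ring.
Qed.

Lemma rintZ k g a b c d : edge_continuous g a b c d ->
  A < a -> a <= b -> A < c -> c <= d ->
  rint (fun z => k * g z) a b c d = k * rint g a b c d.
Proof.
case=> g1 g2 g3 g4 Aa ab Ac cd; rewrite /rint.
rewrite (cintZ k g1 Aa ab) (cintZ k g2 Aa ab) (cintZ k g3 Ac cd) (cintZ k g4 Ac cd).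
by ring.
Qed.

Lemma rint_bound g a b c d M : edge_continuous g a b c d ->
  A < a -> a <= b -> A < c -> c <= d ->
  (forall z, edge a b c d z -> normc (g z) <= M) ->
  normc (rint g a b c d) <= 4 * M * ((b - a) + (d - c)).
Proof.
case=> g1 g2 g3 g4 Aa ab Ac cd HM.
have B1 := cint_bound (M := M) g1 Aa ab; have B2 := cint_bound (M := M) g2 Aa ab.
have B3 := cint_bound (M := M) g3 Ac cd; have B4 := cint_bound (M := M) g4 Ac cd.
have {}B1 : normc (cint A (fun x => g (x +i* c)) a b) <= 2 * M * (b - a).
  by apply: B1 => x ax xb; apply: HM; rewrite /edge /= ax xb cd lexx eqxx !orbT.
have {}B2 : normc (cint A (fun x => g (x +i* d)) a b) <= 2 * M * (b - a).
  by apply: B2 => x ax xb; apply: HM; rewrite /edge /= ax xb cd lexx eqxx !orbT.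
have {}B3 : normc (cint A (fun x => g (a +i* x)) c d) <= 2 * M * (d - c).
  by apply: B3 => x ax xb; apply: HM; rewrite /edge /= ax xb ab lexx eqxx.
have {}B4 : normc (cint A (fun x => g (b +i* x)) c d) <= 2 * M * (d - c).
  by apply: B4 => x ax xb; apply: HM; rewrite /edge /= ax xb ab lexx eqxx !orbT.
have ni : normc ii = 1 by rewrite normc_imag normr1.
rewrite /rint.
have T1 := normc_tri (cint A (fun x => g (x +i* c)) a b + ii * cint A (fun y => g (b +i* y)) c d
  - cint A (fun x => g (x +i* d)) a b) (ii * cint A (fun y => g (a +i* y)) c d).
have T2 := normc_tri (cint A (fun x => g (x +i* c)) a b + ii * cint A (fun y => g (b +i* y)) c d)
   (cint A (fun x => g (x +i* d)) a b).
have T3 := le_normcD (cint A (fun x => g (x +i* c)) a b) (ii * cint A (fun y => g (b +i* y)) c d).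
rewrite normcM ni mul1r in T1; rewrite normcM ni mul1r in T3.
lra.
Qed.

(** Explicit primitives exist on each side. This is the case of Cauchy's theorem needed for the
    tangent map subtracted in [goursat]. *)
Lemma rint_affine (k l : R[i]) a b c d : A < a -> a <= b -> A < c -> c <= d ->
  rint (fun z => k + l * z) a b c d = 0.
Proof.
move=> Aa ab Ac cd.
have ct : continuous (fun z : Cplx R => k + l * z : Cplx R).
  have lc : continuous (fun z : Cplx R => (l : Cplx R) * z) by exact: mulrl_continuous.
  have kc : continuous (fun z : Cplx R => k : Cplx R) by exact: cst_continuous.
  by move=> z; exact: (cvgD (kc z) (lc z)).
have [c1 c2 c3 c4] := @continuous_edge _ a b c d ct.
have hE (y : R) : (fun x : R => k + l * (x +i* y)) = (fun x => (k + l * ii * y%:C) + l * x%:C).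
  apply/funext => x; rewrite -addrA -mulrA -mulrDr; congr (_ + _ * _).
  by apply/eqP; rewrite eq_complex /=; apply/andP; split; apply/eqP; ring.
have vE (x : R) : (fun y : R => k + l * (x +i* y)) = (fun y => (k + l * x%:C) + (l * ii) * y%:C).
  apply/funext => y; rewrite -addrA -mulrA -mulrDr; congr (_ + _ * _).
  by apply/eqP; rewrite eq_complex /=; apply/andP; split; apply/eqP; ring.
have Paff (k' l' : R[i]) := is_primD (@is_prim_cst R A k') (is_primZ l' (@is_prim_id R A)).
rewrite /rint; rewrite hE in c1; rewrite hE in c2; rewrite vE in c3; rewrite vE in c4.
rewrite !hE !vE (cint_prim c1 (Paff _ _) Aa ab) (cint_prim c2 (Paff _ _) Aa ab).
rewrite (cint_prim c3 (Paff _ _) Ac cd) (cint_prim c4 (Paff _ _) Ac cd).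
by ring.
Qed.

Lemma rint_vsplit g a m b c d : rint g a m c d + rint g m b c d = rint g a b c d.
Proof.
rewrite /rint -(cint_split A (fun x => g (x +i* c)) a m b).
by rewrite -(cint_split A (fun x => g (x +i* d)) a m b); ring.
Qed.

Lemma rint_hsplit g a b c m d : rint g a b c m + rint g a b m d = rint g a b c d.
Proof.
rewrite /rint -(cint_split A (fun x => g (a +i* x)) c m d).
by rewrite -(cint_split A (fun x => g (b +i* x)) c m d); ring.
Qed.

End RectangleIntegral.

(** * Goursat's theorem, with and without an exceptional point *)

Section Goursat.
Variables (R : realType) (A : R).
Implicit Types (g h : Cplx R -> Cplx R) (a b c d : R).

Lemma continuous_affine (k l : R[i]) : continuous (fun z : Cplx R => k + l * z : Cplx R).
Proof.
have lc : continuous (fun z : Cplx R => (l : Cplx R) * z) by exact: mulrl_continuous.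
have kc : continuous (fun z : Cplx R => k : Cplx R) by exact: cst_continuous.
by move=> z; exact: (cvgD (kc z) (lc z)).
Qed.

Lemma goursat g a b c d : continuous g -> A < a -> a <= b -> A < c -> c <= d ->
  (forall z : R[i], a <= Re z <= b -> c <= Im z <= d -> exists l, cdiff g z l) ->
  rint A g a b c d = 0.
Proof.
move=> cg Aa0 ab0 Ac0 cd0 gd; apply: eq0_normc; apply/eqP; rewrite eq_le normc_ge0 andbT.
(* The sum of the squares of the sides replaces the area: quartering divides it by four as well, and
   it still dominates the squared half-perimeter, up to a factor 2, when the rectangle is thin. *)
suff H e : 0 < e -> normc (rint A g a b c d) <= e * ((b - a) ^+ 2 + (d - c) ^+ 2).
  apply/ler_addgt0Pr => e e0; rewrite add0r.
  pose S := (b - a) ^+ 2 + (d - c) ^+ 2.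
  have S0 : 0 <= S by rewrite addr_ge0 ?sqr_ge0.
  have S1 : 0 < S + 1 by rewrite ltr_wpDl.
  apply: (le_trans (H (e / (S + 1)) _)); first by rewrite divr_gt0.
  by rewrite -/S -mulrA ger_pMr // mulrC ler_pdivrMr // mul1r lerDl.
move=> e0.
apply: (rectangle_bisection
  (P := fun a b c d => normc (rint A g a b c d) <= e * ((b - a) ^+ 2 + (d - c) ^+ 2))) => //.
  move=> a1 b1 c1 d1 _ _ _ _ _ _.
  set m := (a1 + b1) / 2; set n := (c1 + d1) / 2.
  rewrite -(rint_vsplit A g a1 m b1) -(rint_hsplit A g a1 m c1 n d1).
  rewrite -(rint_hsplit A g m b1 c1 n d1).
  have -> : m - a1 = (b1 - a1) / 2 by rewrite /m; field.
  have -> : b1 - m = (b1 - a1) / 2 by rewrite /m; field.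
  have -> : n - c1 = (d1 - c1) / 2 by rewrite /n; field.
  have -> : d1 - n = (d1 - c1) / 2 by rewrite /n; field.
  have -> : e * (((b1 - a1) / 2) ^+ 2 + ((d1 - c1) / 2) ^+ 2) =
            e * ((b1 - a1) ^+ 2 + (d1 - c1) ^+ 2) / 4 by field.
  move=> h1 h2 h3 h4.
  have T1 := le_normcD (rint A g a1 m c1 n) (rint A g a1 m n d1).
  have T2 := le_normcD (rint A g m b1 c1 n) (rint A g m b1 n d1).
  have T3 := le_normcD (rint A g a1 m c1 n + rint A g a1 m n d1)
    (rint A g m b1 c1 n + rint A g m b1 n d1).
  lra.
move=> p q pab qcd.
have [l Hl] := gd (p +i* q) pab qcd.
(* With half-perimeter [s], [rint_bound] will give [4 (e / 8) s^2 = e s^2 / 2], which is at most [e]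
   times the sum of squares. *)
have e8 : 0 < e / 8 by lra.
have [r r0 Hr] := Hl _ e8.
exists (r / 2); first by lra.
move=> a1 b1 c1 d1 aa bb cc dd pab1 qcd1 w1 w2.
set s := (b1 - a1) + (d1 - c1).
(* [k - l z] is minus the tangent map of [g] at [(p, q)]: adding it keeps the integral and turns the
   integrand into the first-order remainder. *)
pose k := l * (p +i* q) - g (p +i* q).
have Aa1 : A < a1 by exact: lt_le_trans aa.
have Ac1 : A < c1 by exact: lt_le_trans cc.
have ab1 : a1 <= b1 by case/andP: pab1; exact: le_trans.
have cd1 : c1 <= d1 by case/andP: qcd1; exact: le_trans.
have cg1 := @continuous_edge _ g a1 b1 c1 d1 cg.
have cl1 := @continuous_edge _ _ a1 b1 c1 d1 (@continuous_affine k (- l)).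
have := rint_bound (M := e / 8 * s) (edge_continuousD cg1 cl1) Aa1 ab1 Ac1 cd1.
rewrite (rintD cg1 cl1 Aa1 ab1 Ac1 cd1) (rint_affine _ _ Aa1 ab1 Ac1 cd1) addr0 => H.
apply: (le_trans (H _)); last first.
  rewrite -/s /s; set x := b1 - a1; set y := d1 - c1.
  have : 0 <= e * (x - y) ^+ 2 by rewrite mulr_ge0 ?sqr_ge0 // ltW.
  have -> : e * (x - y) ^+ 2 = e * (x ^+ 2 + y ^+ 2) - 2 * (e * x * y) by ring.
  have -> : 4 * (e / 8 * (x + y)) * (x + y) = (e * (x ^+ 2 + y ^+ 2) + 2 * (e * x * y)) / 2 by field.
  by move=> ?; lra.
move=> z /andP[/andP[zab zcd] _].
pose h := z - (p +i* q).
have hs : normc h <= s.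
  apply: (le_trans (normc_le_ReIm _)); rewrite /h !raddfB /=.
  move: pab1 qcd1 zab zcd => /andP[? ?] /andP[? ?] /andP[? ?] /andP[? ?].
  by apply: lerD; rewrite ler_norml; apply/andP; split; lra.
have hr : normc h < r by apply: (le_lt_trans hs); rewrite /s; lra.
have := Hr _ hr.
have -> : (p +i* q) + h = z by rewrite /h addrC subrK.
have -> : g z - g (p +i* q) - l * h = g z + (k + - l * z) by rewrite /h /k; ring.
by move/le_trans; apply; rewrite ler_wpM2l // ltW.
Qed.

(* Excise a small square around the exceptional point: its contribution is
   bounded by a constant times its perimeter. *)
Lemma goursat_punctured g a b c d (w : R[i]) : continuous g -> A < a -> A < c ->
  a < Re w < b -> c < Im w < d ->
  (forall z : R[i], z != w -> a <= Re z <= b -> c <= Im z <= d -> exists l, cdiff g z l) ->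
  rint A g a b c d = 0.
Proof.
case: w => p q /= cg Aa Ac /andP[ap pb] /andP[cq qd] gd.
apply: eq0_normc; apply/eqP; rewrite eq_le normc_ge0 andbT.
have [r r0 Hr] : exists2 r : R, 0 < r & forall z, normc (z - (p +i* q)) < r ->
    normc (g z) <= normc (g (p +i* q)) + 1.
  have /cvgC /(_ 1 ltr01) /nearC[r r0 Hr] := cg (p +i* q).
  exists r => // z /Hr zr; rewrite -[g z](subrK (g (p +i* q))).
  by apply: (le_trans (le_normcD _ _)); rewrite addrC lerD2l ltW.
set M := normc _ + 1 in Hr.
have M0 : 0 < M by rewrite ltr_wpDl // normc_ge0.
apply/ler_addgt0Pr => e e0; rewrite add0r.
(* Half the side of the excised square, which must fit in the rectangle and in the disc of radius
   [r] where [M] bounds [g]. Its half-perimeter is [4 t], so [rint_bound] yields [16 M t]. *)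
have [t [t0 t1 t2 [t3 t4 t5 t6]]] : exists t, [/\ 0 < t, a < p - t, p + t < b &
    [/\ c < q - t, q + t < d, t < r / 2 & 16 * M * t < e]].
  exists (Num.min (Num.min (Num.min (p - a) (b - p)) (Num.min (q - c) (d - q)))
     (Num.min (r / 2) (e / (16 * M))) / 2).
  set t := Num.min _ _.
  have tE : t <= t by [].
  have eM : 0 < e / (16 * M) by rewrite divr_gt0 // mulr_gt0.
  have t0 : 0 < t by rewrite /t !lt_min !subr_gt0 ap pb cq qd eM divr_gt0.
  move: tE; rewrite {2}/t !le_min => /andP[/andP[/andP[? ?] /andP[? ?]] /andP[? te]].
  do !split; try lra.
  by rewrite mulrC -ltr_pdivlMr ?mulr_gt0 //; lra.
have off a1 b1 c1 d1 : A < a1 -> a <= a1 -> a1 <= b1 -> b1 <= b -> A < c1 -> c <= c1 -> c1 <= d1 ->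
   d1 <= d -> ~~ (a1 <= p <= b1) || ~~ (c1 <= q <= d1) -> rint A g a1 b1 c1 d1 = 0.
  move=> Aa1 aa1 ab1 bb1 Ac1 cc1 cd1 dd1 out; apply: goursat => // z zab zcd.
  apply: gd.
  - by apply: contraTneq out => zE; move: zab zcd; rewrite zE /= => -> ->.
  - by case/andP: zab => *; apply/andP; split; lra.
  - by case/andP: zcd => *; apply/andP; split; lra.
(* Five pieces: the strips below and above the small square, the rectangles to its left and right,
   and the square itself, the only one containing [w]. *)
rewrite -(rint_hsplit A g a b c (q - t) d) -(rint_hsplit A g a b (q - t) (q + t) d).
rewrite -(rint_vsplit A g a (p - t) b (q - t) (q + t)) -(rint_vsplit A g (p - t) (p + t) b (q - t) (q + t)).
rewrite (off a b c); [|lra..|by apply/orP; right; apply/negP => /andP[? ?]; lra].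
rewrite (off a b _ d); [|lra..|by apply/orP; right; apply/negP => /andP[? ?]; lra].
rewrite (off a (p - t)); [|lra..|by apply/orP; left; apply/negP => /andP[? ?]; lra].
rewrite (off _ b (q - t)); [|lra..|by apply/orP; left; apply/negP => /andP[? ?]; lra].
rewrite add0r addr0 add0r addr0.
have := rint_bound (A := A) (M := M) (@continuous_edge _ g (p - t) (p + t) (q - t) (q + t) cg).
move=> H; apply: (le_trans (H _ _ _ _ _)); [lra..| |].
  move=> z /andP[/andP[/andP[? ?] /andP[? ?]] _]; apply: Hr.
  apply: (le_lt_trans (normc_le_ReIm _)); rewrite !raddfB /=.
  have ? : `|Re z - p| <= t by rewrite ler_norml; apply/andP; split; lra.
  have ? : `|Im z - q| <= t by rewrite ler_norml; apply/andP; split; lra.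
  by lra.
have -> : p + t - (p - t) + (q + t - (q - t)) = 4 * t by ring.
have -> : 4 * M * (4 * t) = 16 * M * t by ring.
exact: ltW.
Qed.

End Goursat.

(** * Integrals over a centred square and the Cauchy kernel *)

Section CauchyKernel.
Variables (R : realType) (r : R).
Hypothesis r0 : 0 < r.
Implicit Types (g h phi : Cplx R -> Cplx R).

Let A := - r - 1.
Let AL : A < - r. Proof. by rewrite /A; lra. Qed.
Let LL : - r <= r. Proof. by move: r0 => ?; lra. Qed.

Definition sint g : R[i] := rint A g (- r) r (- r) r.
Definition sedge z := edge (- r) r (- r) r z.
Definition sedge_continuous g := edge_continuous g (- r) r (- r) r.

Lemma sintD g h : sedge_continuous g -> sedge_continuous h ->
  sint (fun z => g z + h z) = sint g + sint h.
Proof. by move=> cg ch; exact: (rintD cg ch AL LL AL LL). Qed.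

Lemma sintZ k g : sedge_continuous g -> sint (fun z => k * g z) = k * sint g.
Proof. by move=> cg; exact: (rintZ k cg AL LL AL LL). Qed.

Lemma sint_bound g M : sedge_continuous g -> (forall z, sedge z -> normc (g z) <= M) ->
  normc (sint g) <= 16 * r * M.
Proof.
move=> cg HM; apply: (le_trans (rint_bound cg AL LL AL LL HM)).
by rewrite le_eqVlt; apply/orP; left; apply/eqP; ring.
Qed.

Lemma sint_ext g h : (forall z, [|| `|Re z| == r | `|Im z| == r] -> g z = h z) ->
  sint g = sint h.
Proof.
move=> gh; rewrite /sint /rint.
have -> : (fun x => g (x +i* - r)) = (fun x => h (x +i* - r)).
  by apply/funext => x; apply: gh => /=; rewrite normrN (gtr0_norm r0) eqxx orbT.
have -> : (fun x => g (x +i* r)) = (fun x => h (x +i* r)).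
  by apply/funext => x; apply: gh => /=; rewrite (gtr0_norm r0) eqxx orbT.
have -> : (fun x => g (- r +i* x)) = (fun x => h (- r +i* x)).
  by apply/funext => x; apply: gh => /=; rewrite normrN (gtr0_norm r0) eqxx.
have -> // : (fun x => g (r +i* x)) = (fun x => h (r +i* x)).
by apply/funext => x; apply: gh => /=; rewrite (gtr0_norm r0) eqxx.
Qed.

(** Differentiation under the integral sign by a plain estimate: the remainder is quadratic in [h]
    uniformly on the contour, and [sint_bound] carries it through. *)
Lemma sint_cdiff (F : R[i] -> Cplx R -> Cplx R) (F' : Cplx R -> Cplx R) (w : R[i]) (e C : R) :
  0 < e -> 0 <= C ->
  (forall v, normc (v - w) < e -> sedge_continuous (F v)) -> sedge_continuous F' ->
  (forall (h z : R[i]), normc h < e -> sedge z ->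
     normc (F (w + h) z - F w z - h * F' z) <= C * normc h ^+ 2) ->
  cdiff (fun v => sint (F v)) w (sint F').
Proof.
move=> e0 C0 cF cF' HF t t0.
have c16 : 0 < 16 * r * C + 1 by rewrite ltr_wpDl // !mulr_ge0 // ltW.
(* Makes [16 r C |h|^2] at most [t |h|]; the [+ 1] covers [C = 0]. *)
exists (Num.min e (t / (16 * r * C + 1))); first by rewrite lt_min e0 divr_gt0.
move=> h; rewrite lt_min => /andP[he ht].
have cw : sedge_continuous (F w) by apply: cF; rewrite subrr normc0.
have cwh : sedge_continuous (F (w + h)) by apply: cF; rewrite addrC addKr.
have cst_c (k : R[i]) : sedge_continuous (fun=> k : Cplx R).
  by apply: continuous_edge; exact: cst_continuous.
have c1 : sedge_continuous (fun z => -1 * F w z) := edge_continuousM (cst_c _) cw.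
have c2 : sedge_continuous (fun z => - h * F' z) := edge_continuousM (cst_c _) cF'.
have c12 : sedge_continuous (fun z => -1 * F w z + - h * F' z) := edge_continuousD c1 c2.
have -> : sint (F (w + h)) - sint (F w) - sint F' * h =
    sint (fun z => F (w + h) z + (-1 * F w z + - h * F' z)).
  by rewrite (sintD cwh c12) (sintD c1 c2) (sintZ _ cw) (sintZ _ cF'); ring.
have H := sint_bound (edge_continuousD cwh c12) (M := C * normc h ^+ 2).
apply: (le_trans (H _)).
  move=> z zE; apply: le_trans (HF h z he zE).
  by rewrite mulN1r mulNr addrA.
have h0 := normc_ge0 h.
rewrite expr2 !mulrA ler_wpM2r //.
move: ht; rewrite ltr_pdivlMr // mulrDr mulr1 mulrC => /ltW ht.
by apply: le_trans ht; rewrite lerDl.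
Qed.

Definition inside (w : R[i]) := (`|Re w| < r) && (`|Im w| < r).

(** For [w] inside, its distance to the four lines carrying the sides; it controls the kernel on the
    contour. *)
Definition margin (w : R[i]) := Num.min (r - `|Re w|) (r - `|Im w|).

Lemma margin_gt0 w : inside w -> 0 < margin w.
Proof. by move=> /andP[? ?]; rewrite lt_min !subr_gt0; apply/andP. Qed.

Lemma margin_le w z : [|| `|Re z| == r | `|Im z| == r] -> margin w <= normc (z - w).
Proof.
rewrite /margin => /orP[] /eqP zr; rewrite ge_min; apply/orP; [left|right].
  apply: le_trans (Re_le_normc _); rewrite raddfB -zr; exact: lerB_dist.
apply: le_trans (Im_le_normc _); rewrite raddfB -zr; exact: lerB_dist.
Qed.

Lemma sedge_line z : sedge z -> [|| `|Re z| == r | `|Im z| == r].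
Proof.
move=> /andP[_ /or4P[] /eqP ->]; rewrite ?normrN ?(gtr0_norm r0) ?eqxx ?orbT //.
Qed.

Lemma line_continuous g :
  (forall z : Cplx R, [|| `|Re z| == r | `|Im z| == r] -> {for z, continuous g}) ->
  sedge_continuous g.
Proof.
move=> cg; split=> x.
- apply: (continuous_comp (@continuous_hline R (- r) x)); apply: cg.
  by rewrite /= normrN (gtr0_norm r0) eqxx orbT.
- apply: (continuous_comp (@continuous_hline R r x)); apply: cg.
  by rewrite /= (gtr0_norm r0) eqxx orbT.
- apply: (continuous_comp (@continuous_vline R (- r) x)); apply: cg.
  by rewrite /= normrN (gtr0_norm r0) eqxx.
- apply: (continuous_comp (@continuous_vline R r x)); apply: cg.
  by rewrite /= (gtr0_norm r0) eqxx.
Qed.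

Lemma inside_near w v : normc (v - w) < margin w -> inside v.
Proof.
rewrite lt_min => /andP[h1 h2]; apply/andP; split.
  have := Re_le_normc (v - w); rewrite raddfB => /le_lt_trans /(_ h1) h.
  by have := ler_normD (Re v - Re w) (Re w); rewrite subrK => /le_lt_trans; apply; lra.
have := Im_le_normc (v - w); rewrite raddfB => /le_lt_trans /(_ h2) h.
by have := ler_normD (Im v - Im w) (Im w); rewrite subrK => /le_lt_trans; apply; lra.
Qed.

Lemma kernel_continuous m w : inside w ->
  sedge_continuous (fun z : Cplx R => (z - w)^-1 ^+ m : Cplx R).
Proof.
move=> iw; elim: m => [|m IH]; first by apply: continuous_edge; exact: cst_continuous.
suff k1 : sedge_continuous (fun z : Cplx R => (z - w)^-1 : Cplx R).
  have -> : (fun z : Cplx R => (z - w)^-1 ^+ m.+1 : Cplx R) =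
      (fun z => ((z - w)^-1 : Cplx R) * ((z - w)^-1 ^+ m : Cplx R)).
    by apply/funext => z; rewrite exprS.
  exact: edge_continuousM k1 IH.
apply: line_continuous => z zl.
have zw : (z : R[i]) - w != 0.
  by rewrite -normc_gt0; apply: lt_le_trans (margin_gt0 iw) (margin_le w zl).
have H : continuous (fun z : Cplx R => z - w : Cplx R).
  have -> : (fun z : Cplx R => z - w : Cplx R) = (fun z => - w + 1 * z : Cplx R).
    by apply/funext => y; rewrite mul1r addrC.
  exact: continuous_affine.
exact: (cvgV zw (H z)).
Qed.

(** Cauchy transform with kernel of order [m], without the factor 1 / (2 pi i). *)
Definition ctransform m phi (w : R[i]) : R[i] :=
  sint (fun z => phi z * (z - w)^-1 ^+ m).

End CauchyKernel.

(** * Differentiability of Cauchy transforms *)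

Section CauchyTransform.
Variables (R : realType) (r : R).
Hypothesis r0 : 0 < r.
Implicit Types (phi : Cplx R -> Cplx R) (w : R[i]).

Lemma normc_cvg (T : Type) (F : set_system T) {FF : Filter F} (f : T -> Cplx R) (l : Cplx R) :
  (f @ F --> l -> (fun x => normc (f x)) @ F --> normc l)%classic.
Proof.
move/cvgC => H; apply/cvgrPdist_lt => e e0; move: (H e e0); apply: filterS => x.
apply: le_lt_trans; rewrite ler_norml; apply/andP; split.
  by rewrite lerNl opprB; exact: normc_trib.
by rewrite normcB; exact: normc_trib.
Qed.

Lemma segment_bounded (phi : R -> Cplx R) : continuous phi ->
  exists M, forall x, - r <= x <= r -> normc (phi x) <= M.
Proof.
move=> cp; have LL : - r <= r by move: r0 => ?; lra.
have [|c _ H] := @EVT_max R (fun x => normc (phi x)) (- r) r LL.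
  by apply: continuous_subspaceT => x; apply: normc_cvg; exact: cp.
by exists (normc (phi c)) => x xr; apply: H; rewrite in_itv.
Qed.

Lemma sedge_bounded phi : sedge_continuous r phi ->
  exists2 M, 0 <= M & forall z, sedge r z -> normc (phi z) <= M.
Proof.
case=> c1 c2 c3 c4.
have [M1 H1] := segment_bounded c1; have [M2 H2] := segment_bounded c2.
have [M3 H3] := segment_bounded c3; have [M4 H4] := segment_bounded c4.
exists (`|M1| + `|M2| + (`|M3| + `|M4|)); first by rewrite !addr_ge0.
have N1 := ler_norm M1; have N2 := ler_norm M2; have N3 := ler_norm M3; have N4 := ler_norm M4.
have P1 := normr_ge0 M1; have P2 := normr_ge0 M2; have P3 := normr_ge0 M3; have P4 := normr_ge0 M4.
case=> x y /andP[/andP[/= xr yr] /or4P[] /eqP E]; rewrite E in xr yr *.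
- by have := H3 _ yr; lra.
- by have := H4 _ yr; lra.
- by have := H1 _ xr; lra.
- by have := H2 _ xr; lra.
Qed.

Section Taylor.
Variables (rho : R) (u h : R[i]).
Hypotheses (rho0 : 0 < rho) (hu : rho <= normc u) (hh : normc h <= rho / 2).

Let uh : rho / 2 <= normc (u - h).
Proof. by have := normc_trib u h; move: hu hh => ? ?; lra. Qed.
Let u0 : u != 0. Proof. by rewrite -normc_gt0; exact: lt_le_trans hu. Qed.
Let uh0 : u - h != 0.
Proof. by rewrite -normc_gt0; apply: lt_le_trans uh; rewrite divr_gt0. Qed.
Let un : (normc u)^-1 <= rho^-1.
Proof. by rewrite lef_pV2 // posrE; exact: lt_le_trans hu. Qed.
Let uhn : (normc (u - h))^-1 <= 2 / rho.
Proof.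
rewrite -[2 / rho]invf_div lef_pV2 // posrE ?divr_gt0 //.
by apply: lt_le_trans uh; rewrite divr_gt0.
Qed.

(** The remainder is exactly [h^2 / (u^2 (u - h))]. The exponent [1] and the factor [1%:R] are kept
    to match the pattern in [m] of [ctransform_cdiff_taylor]. *)
Lemma inv_taylor1 : normc ((u - h)^-1 ^+ 1 - u^-1 ^+ 1 - h * (1%:R * u^-1 ^+ 2)) <=
  2 / rho ^+ 3 * normc h ^+ 2.
Proof.
have -> : (u - h)^-1 ^+ 1 - u^-1 ^+ 1 - h * (1%:R * u^-1 ^+ 2) =
    h * h * (u^-1 * u^-1 * (u - h)^-1) by field; rewrite u0 uh0.
rewrite !normcM !normcV -expr2 mulrC ler_wpM2r ?sqr_ge0 //.
have -> : 2 / rho ^+ 3 = rho^-1 * rho^-1 * (2 / rho) by field; rewrite gt_eqF.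
by rewrite !ler_pM ?mulr_ge0 ?invr_ge0 ?normc_ge0.
Qed.

Lemma inv_taylor2 : normc ((u - h)^-1 ^+ 2 - u^-1 ^+ 2 - h * (2%:R * u^-1 ^+ 3)) <=
  16 / rho ^+ 4 * normc h ^+ 2.
Proof.
have -> : (u - h)^-1 ^+ 2 - u^-1 ^+ 2 - h * (2%:R * u^-1 ^+ 3) =
    h * h * ((u^-1 * u^-1 * (u - h)^-1) * ((u - h)^-1 + 2 * u^-1)).
  by field; rewrite u0 uh0.
have n2 : normc (2 : R[i]) = 2.
  by rewrite -[2 : R[i]](rmorph_nat (real_complex R)) normc_real normr_nat.
rewrite normcM [normc (h * h)]normcM -expr2 mulrC ler_wpM2r ?sqr_ge0 //.
have -> : 16 / rho ^+ 4 = (rho^-1 * rho^-1 * (2 / rho)) * (8 / rho) by field; rewrite gt_eqF.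
rewrite normcM ler_pM ?normc_ge0 //.
  by rewrite !normcM !normcV !ler_pM ?mulr_ge0 ?invr_ge0 ?normc_ge0.
apply: (le_trans (le_normcD _ _)); rewrite normcM n2 !normcV.
have ri : 0 < rho^-1 by rewrite invr_gt0.
by move: un uhn => ? ?; lra.
Qed.

End Taylor.

(** The hypothesis, at [u = z - w], is a Taylor estimate of the kernel in [w]. It is applied for [m]
    equal to 1, to express the derivative of [f], and to 2, to differentiate that expression. *)
Lemma ctransform_cdiff_taylor phi w m (C : R) : sedge_continuous r phi -> inside r w ->
  0 <= C ->
  (forall u h : R[i], margin r w <= normc u -> normc h <= margin r w / 2 ->
    normc ((u - h)^-1 ^+ m - u^-1 ^+ m - h * (m%:R * u^-1 ^+ m.+1)) <= C * normc h ^+ 2) ->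
  cdiff (ctransform r m phi) w (m%:R * ctransform r m.+1 phi w).
Proof.
move=> cp iw C0 T; have m0 := margin_gt0 iw.
have [M M0 HM] := sedge_bounded cp.
have ck v k : inside r v -> sedge_continuous r (fun z => phi z * (z - v)^-1 ^+ k).
  by move=> iv; exact: edge_continuousM cp (kernel_continuous r0 k iv).
rewrite -(sintZ r0 _ (ck w m.+1 iw)).
apply: (@sint_cdiff R r r0 (fun v z => phi z * (z - v)^-1 ^+ m) _ w (margin r w / 2) (M * C)).
- by rewrite divr_gt0.
- by rewrite mulr_ge0.
- by move=> v vw; apply: ck; apply: (@inside_near _ _ w); apply: lt_trans vw _; lra.
- apply: edge_continuousM (ck w m.+1 iw).
  by apply: continuous_edge; exact: cst_continuous.
move=> h z hm zE; have zl := margin_le w (sedge_line r0 zE).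
have -> : phi z * (z - (w + h))^-1 ^+ m - phi z * (z - w)^-1 ^+ m -
    h * (m%:R * (phi z * (z - w)^-1 ^+ m.+1)) =
  phi z * (((z - w) - h)^-1 ^+ m - (z - w)^-1 ^+ m - h * (m%:R * (z - w)^-1 ^+ m.+1)).
  by rewrite opprD addrA; ring.
rewrite normcM -mulrA ler_pM ?normc_ge0 //; first exact: HM.
by apply: T => //; exact: ltW.
Qed.

Lemma ctransform_cdiff1 phi w : sedge_continuous r phi -> inside r w ->
  cdiff (ctransform r 1 phi) w (ctransform r 2 phi w).
Proof.
move=> cp iw; have m0 := margin_gt0 iw.
rewrite -[X in cdiff _ _ X]mul1r; apply: (ctransform_cdiff_taylor (C := 2 / margin r w ^+ 3)) => //.
  by rewrite divr_ge0 // exprn_ge0 // ltW.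
by move=> u h; exact: inv_taylor1.
Qed.

Lemma ctransform_cdiff2 phi w : sedge_continuous r phi -> inside r w ->
  cdiff (ctransform r 2 phi) w (2 * ctransform r 3 phi w).
Proof.
move=> cp iw; have m0 := margin_gt0 iw.
apply: (ctransform_cdiff_taylor (C := 16 / margin r w ^+ 4)) => //.
  by rewrite divr_ge0 // exprn_ge0 // ltW.
by move=> u h; exact: inv_taylor2.
Qed.

Lemma inside0 : inside r 0.
Proof. by rewrite /inside /= normr0 r0. Qed.

(* Opposite sides contribute equally, and the integrand [2 i r / (x^2 + r^2)] of a
   pair lies between [i / r] and [2 i / r]. *)
Lemma ctransform1_neq0 : ctransform r 1 (fun=> 1) 0 != 0.
Proof.
have [k1 k2 k3 k4] := kernel_continuous r0 1 inside0.
set f1 := (fun x => _) in k1; set f2 := (fun x => _) in k2.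
set f3 := (fun x => _) in k3; set f4 := (fun x => _) in k4.
pose A := - r - 1; have AL : A < - r by rewrite /A; lra.
have LL : - r <= r by move: r0 => ?; lra.
pose ii : R[i] := 0 +i* 1.
have cst_c (k : R[i]) : continuous (fun _ : R => k : Cplx R) by exact: cst_continuous.
have cM (k : R[i]) (g : R -> Cplx R) : continuous g -> continuous (fun x => (k : Cplx R) * g x).
  by move=> cg x; exact: (cvgM (cst_c k x) (cg x)).
have cD (g h : R -> Cplx R) : continuous g -> continuous h -> continuous (fun x => g x + h x).
  by move=> cg ch x; exact: (cvgD (cg x) (ch x)).
pose g x : Cplx R := f1 x + -1 * f2 x.
have cg : continuous g by exact: cD k1 (cM _ _ k2).
have gE x : g x = 0 +i* (2 * r / (x ^+ 2 + r ^+ 2)).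
  have n0 : x ^+ 2 + r ^+ 2 != 0 by rewrite gt_eqF // ltr_wpDl ?sqr_ge0 ?exprn_gt0.
  rewrite /g /f1 /f2 !subr0 !expr1 mulN1r; apply/eqP; rewrite eq_complex /= sqrrN.
  by apply/andP; split; apply/eqP; field.
have gE' x : g x = ii * f4 x + (- ii) * f3 x.
  have n0 : x ^+ 2 + r ^+ 2 != 0 by rewrite gt_eqF // ltr_wpDl ?sqr_ge0 ?exprn_gt0.
  have n0' : r ^+ 2 + x ^+ 2 != 0 by rewrite addrC.
  rewrite gE /f3 /f4 !subr0 !expr1 /ii; apply/eqP; rewrite eq_complex /= sqrrN.
  by apply/andP; split; apply/eqP; field; rewrite ?n0 ?n0'.
have E : ctransform r 1 (fun=> 1) 0 = 2 * cint A g (- r) r.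
  have -> : ctransform r 1 (fun=> 1) 0 = sint r (fun z => (z - 0)^-1 ^+ 1).
    by apply: (sint_ext r0) => z _; rewrite mul1r.
  have e1 : cint A g (- r) r = cint A f1 (- r) r - cint A f2 (- r) r.
    by rewrite (cintD k1 (cM _ _ k2) AL LL) (cintZ _ k2 AL LL) mulN1r.
  have e2 : cint A g (- r) r = ii * cint A f4 (- r) r - ii * cint A f3 (- r) r.
    have -> : g = (fun x => ii * f4 x + (- ii) * f3 x) by apply/funext => x; exact: gE'.
    by rewrite (cintD (cM _ _ k4) (cM _ _ k3) AL LL) (cintZ _ k4 AL LL) (cintZ _ k3 AL LL) mulNr.
  rewrite mulrDl mul1r {1}e1 e2 /sint /rint -/f1 -/f2 -/f3 -/f4 -/ii -/A; ring.
rewrite E mulf_neq0 ?pnatr_eq0 //; apply/eqP => g0.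
(* [- k] is the midpoint of the segment containing the values of [g], so [g + k] has modulus at most
   [1 / (2 r)]. If the integral of [g] were 0, that of [k], of modulus 3, would be at most 2:
   centring makes up for the factor 2 lost in [cint_bound]. *)
pose k : R[i] := 0 +i* - (3 / (2 * r)).
have := @cint_bound R A (fun x => g x + k) (- r) r (1 / (2 * r)) (cD _ _ cg (cst_c k)) AL LL.
rewrite (cintD cg (cst_c k) AL LL) g0 add0r.
rewrite (cint_prim (cst_c k) (@is_prim_cst R A k) AL LL) -mulrBr -rmorphB normcM.
rewrite normc_imag normc_real => H.
have {H} : `|- (3 / (2 * r))| * `|r - - r| <= 2 * (1 / (2 * r)) * (r - - r).
  apply: H => x xl xr.
  have -> : g x + k = 0 +i* (2 * r / (x ^+ 2 + r ^+ 2) - 3 / (2 * r)).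
    by rewrite gE; apply/eqP; rewrite eq_complex /= addr0 !eqxx.
  rewrite normc_imag.
  have x2 : x ^+ 2 <= r ^+ 2.
    have : 0 <= (r - x) * (r + x) by apply: mulr_ge0; lra.
    have -> : (r - x) * (r + x) = r ^+ 2 - x ^+ 2 by ring.
    by rewrite subr_ge0.
  have n0 : 0 < x ^+ 2 + r ^+ 2 by rewrite ltr_wpDl ?sqr_ge0 ?exprn_gt0.
  have -> : 2 * r / (x ^+ 2 + r ^+ 2) - 3 / (2 * r) =
     (r ^+ 2 - 3 * x ^+ 2) / (x ^+ 2 + r ^+ 2) * (1 / (2 * r)).
    by field; rewrite !gt_eqF.
  have ri : 0 < 1 / (2 * r) by rewrite divr_gt0 // mulr_gt0.
  rewrite normrM [`|1 / _|]gtr0_norm // ler_piMl // ?(ltW ri) //.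
  rewrite normrM normfV [`|x ^+ 2 + _|]gtr0_norm // ler_pdivrMr // mul1r ler_norml.
  by have x20 := sqr_ge0 x; apply/andP; split; lra.
have rp : 0 < 3 / (2 * r) by rewrite divr_gt0 // mulr_gt0.
have rm : 0 < r - - r by move: r0 => ?; lra.
rewrite normrN !gtr0_norm //.
have -> : 3 / (2 * r) * (r - - r) = 3 by field; rewrite gt_eqF.
have -> : 2 * (1 / (2 * r)) * (r - - r) = 2 by field; rewrite gt_eqF.
lra.
Qed.

End CauchyTransform.

(** * The derivative of a holomorphic function is holomorphic *)

Section HolomorphicDerivative.
Variable R : realType.
Implicit Types (f g : Cplx R -> Cplx R) (z w l : R[i]).

Lemma cdiff_continuous f z l : cdiff f z l -> {for (z : Cplx R), continuous f}.
Proof.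
by move=> /cdiff_derivable H; apply: differentiable_continuous; apply/derivable1_diffP.
Qed.

Lemma cdiff_near f g z l (d : R) : 0 < d -> (forall y, normc (y - z) < d -> g y = f y) ->
  cdiff f z l -> cdiff g z l.
Proof.
move=> d0 gf H e e0; have [t t0 Ht] := H e e0.
exists (Num.min d t); first by rewrite lt_min d0.
move=> h; rewrite lt_min => /andP[hd ht].
rewrite !gf ?subrr ?normc0 //; first exact: Ht.
by rewrite addrC addKr.
Qed.

Lemma cdiff_unique f z l l' : cdiff f z l -> cdiff f z l' -> l = l'.
Proof. by move=> /is_derive_cdiff [_ <-] /is_derive_cdiff [_ <-]. Qed.

Section Clamp.
Variable s : R.
Hypothesis s0 : 0 < s.

(** Applied to both coordinates, a retraction of the plane onto a square. Contour integrals want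
    functions continuous everywhere; [f] after this retraction is one, and equals [f] on the
    square. *)
Definition clampR (x : R) := Num.max (- s) (Num.min x s).
Definition clamp (z : Cplx R) : Cplx R := clampR (Re z) +i* clampR (Im z).

Lemma clampR_le x : `|clampR x| <= s.
Proof.
by rewrite /clampR ler_norml le_max lexx /= ge_max ge_min lexx orbT andbT; move: s0 => ?; lra.
Qed.

Lemma clampR_id x : `|x| <= s -> clampR x = x.
Proof.
by rewrite ler_norml => /andP[h1 h2]; rewrite /clampR min_l // max_r.
Qed.

Lemma clampR_lipschitz x y : `|clampR x - clampR y| <= `|x - y|.
Proof.
have N1 := ler_norm (x - y); have N2 := ler_norm (y - x); rewrite distrC in N2.
have maxl u v : `|u - v| <= `|x - y| -> `|Num.max (- s) u - Num.max (- s) v| <= `|x - y|.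
  rewrite !ler_norml => /andP[h1 h2].
  by case: (leP (- s) u) => ?; case: (leP (- s) v) => ?; apply/andP; split; lra.
apply: maxl; rewrite ler_norml.
by case: (leP x s) => ?; case: (leP y s) => ?; apply/andP; split; lra.
Qed.

Lemma clampR_continuous : continuous clampR.
Proof.
move=> x; apply/cvgrPdist_lt => e e0; near=> y.
apply: (le_lt_trans (clampR_lipschitz _ _)); near: y.
by move: e e0; apply/cvgrPdist_lt; exact: cvg_id.
Unshelve. all: by end_near. Qed.

Lemma clamp_continuous : continuous clamp.
Proof.
move=> z.
have idz : ((fun y : Cplx R => y) @ nbhs z --> z)%classic by exact: cvg_id.
have cre : ((fun y : Cplx R => clampR (Re y)) @ nbhs z --> clampR (Re z))%classic.
  exact: (cvg_comp _ _ (Re_cvg idz) (@clampR_continuous (Re z))).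
have cim : ((fun y : Cplx R => clampR (Im y)) @ nbhs z --> clampR (Im z))%classic.
  exact: (cvg_comp _ _ (Im_cvg idz) (@clampR_continuous (Im z))).
exact: ReIm_cvg cre cim.
Qed.

End Clamp.

Section CauchyFormula.
Variables (r s : R) (f : Cplx R -> Cplx R).
Hypotheses (r0 : 0 < r) (rs : r < s).
Hypothesis fd : forall z, `|Re z| <= s -> `|Im z| <= s -> exists l, cdiff f z l.

Let s0 : 0 < s. Proof. exact: lt_trans rs. Qed.

Definition fclamp (z : Cplx R) : Cplx R := f (clamp s z).

Lemma fclamp_continuous : continuous fclamp.
Proof.
move=> z; have [||l Hl] := fd (z := clamp s z); [exact: clampR_le|exact: clampR_le|].
exact: (continuous_comp (@clamp_continuous s z) (cdiff_continuous Hl)).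
Qed.

Lemma fclamp_id z : `|Re z| <= s -> `|Im z| <= s -> fclamp z = f z.
Proof. by case: z => a b /= ? ?; rewrite /fclamp /clamp /= !clampR_id. Qed.

Lemma fclamp_cdiff z l : `|Re z| < s -> `|Im z| < s -> cdiff f z l -> cdiff fclamp z l.
Proof.
move=> h1 h2; apply: (@cdiff_near _ _ _ _ (margin s z)); first by apply: margin_gt0; rewrite /inside h1.
move=> y yz; have /andP[? ?] := inside_near yz.
by apply: fclamp_id; apply: ltW.
Qed.

(** The difference quotient of [f] at [w], completed by the derivative, is continuous, and derivable
    off [w], so [goursat_punctured] makes its integral 0; expanding it on the contour gives the
    formula. *)
Lemma cauchy_square w : inside r w ->
  f w * ctransform r 1 (fun=> 1) w = ctransform r 1 fclamp w.
Proof.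
move=> iw; have /andP[wr wi] := iw.
have wsr : `|Re w| < s by exact: lt_trans rs.
have wsi : `|Im w| < s by exact: lt_trans rs.
have [l Hl] := fd (ltW wsr) (ltW wsi).
have Hl' := fclamp_cdiff wsr wsi Hl.
have fw : fclamp w = f w by apply: fclamp_id; exact: ltW.
pose q (z : Cplx R) : Cplx R := (fclamp z - f w) * ((z : Cplx R) - w)^-1.
pose g (z : Cplx R) : Cplx R := if z == w then l else q z.
have gq (z : Cplx R) : z != w -> forall y, normc (y - z) < normc (z - w) -> g y = q y.
  move=> zw y yz; rewrite /g; case: eqP => // yw.
  by move: yz; rewrite yw normcB ltxx.
have nzw (z : Cplx R) : z != w -> 0 < normc (z - w) by rewrite normc_gt0 subr_eq0.
have gc : continuous g.
  suff gc (z : Cplx R) : {for z, continuous g} by exact: gc.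
  have [->|zw] := eqVneq z w.
    apply/continuousC => e e0.
    have e2 : 0 < e / 2 by lra.
    have [d d0 Hd] := Hl' _ e2; exists d => // y yd; rewrite /g eqxx.
    case: eqP => [_|/eqP yw]; first by rewrite subrr normc0.
    have ywE : (w : Cplx R) + (y - w) = y by rewrite addrC subrK.
    have := Hd _ yd; rewrite ywE fw /q => H.
    have nyw := nzw _ yw.
    rewrite -(ltr_pM2r nyw) -normcM.
    apply: (@le_lt_trans _ _ (e / 2 * normc (y - w))); last by rewrite ltr_pM2r //; lra.
    have -> // : ((fclamp y - f w) * (y - w)^-1 - l) * (y - w) = fclamp y - f w - l * (y - w).
    by rewrite mulrBl mulfVK // subr_eq0.
  have qc : {for z, continuous q}.
    have fc := @fclamp_continuous z.
    have kc (k : Cplx R) : {for z, continuous (fun _ : Cplx R => k)} by exact: cst_continuous.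
    have zw0 : (z : Cplx R) - w != 0 by rewrite subr_eq0.
    exact: (cvgM (cvgB fc (kc (f w))) (cvgV zw0 (cvgB cvg_id (kc w)))).
  apply/continuousC => e e0; move/continuousC: qc => /(_ e e0)[d d0 Hd].
  exists (Num.min d (normc (z - w))); first by rewrite lt_min d0 nzw.
  move=> y; rewrite lt_min => /andP[yd yzw].
  by rewrite (gq z zw y yzw) (gq z zw z) ?subrr ?normc0 ?nzw //; exact: Hd.
have gI : sint r g = 0.
  have [? ?] : -r < Re w < r /\ -r < Im w < r by rewrite -!ltr_norml.
  apply: (@goursat_punctured R _ g _ _ _ _ w gc) => //; [lra|lra|].
  move=> z zw; rewrite -!ler_norml => zr zi.
  have zsr : `|Re z| < s by exact: le_lt_trans rs.
  have zsi : `|Im z| < s by exact: le_lt_trans rs.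
  have [m Hm] := fd (ltW zsr) (ltW zsi).
  have /cdiff_derivable D := fclamp_cdiff zsr zsi Hm.
  exists (derive1 q z); apply: (cdiff_near (nzw z zw) (gq z zw)).
  apply: derivable_cdiff; apply: derivableM.
    by apply: derivableB; [exact: D|exact: derivable_cst].
  apply: derivableV; first by rewrite subr_eq0.
  by apply: derivableB; [exact: derivable_id|exact: derivable_cst].
have cc (k : R[i]) : sedge_continuous r (fun=> k : Cplx R).
  by apply: continuous_edge; exact: cst_continuous.
have ck := kernel_continuous r0 1 iw.
have c1 := edge_continuousM (cc 1) ck.
have c2 : sedge_continuous r (fun z => fclamp z * (z - w)^-1 ^+ 1).
  by apply: edge_continuousM ck; apply: continuous_edge; exact: fclamp_continuous.
have c3 := edge_continuousM (cc (- f w)) c1.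
have : sint r g = sint r (fun z => fclamp z * (z - w)^-1 ^+ 1 + - f w * (1 * (z - w)^-1 ^+ 1)).
  apply: (sint_ext r0) => z zl.
  have zw : z != w.
    by rewrite -subr_eq0 -normc_gt0; apply: lt_le_trans (margin_gt0 iw) (margin_le w zl).
  by rewrite /g (negbTE zw) /q expr1; ring.
rewrite (sintD r0 c2 c3) (sintZ r0 _ c1) gI => /eqP.
by rewrite eq_sym mulNr subr_eq0 => /eqP.
Qed.

End CauchyFormula.

(** Differentiating [f K = L], the two integrals of Cauchy's formula, and solving gives
    [f' = (L' - f K') / K] near 0, where [K] does not vanish. The right-hand side is derivable at 0
    since the transforms of order 2 are. *)
Lemma derivable_derive1_at0 f : holo_near f 0 -> derivable (f^`())%classic 0 1.
Proof.
move=> /nearC[d d0 Hd].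
(* On the square of half side [s], [|z| <= 2 s < d]. *)
pose s := d / 3; pose r := s / 2.
have s0 : 0 < s by rewrite divr_gt0.
have r0 : 0 < r by rewrite divr_gt0.
have rs : r < s by rewrite /r; lra.
have fder z : `|Re z| <= s -> `|Im z| <= s -> derivable f z 1.
  move=> zr zi; apply: Hd; rewrite subr0; apply: (le_lt_trans (normc_le_ReIm _)).
  by move: zr zi; rewrite /s => ? ?; lra.
have fd z : `|Re z| <= s -> `|Im z| <= s -> exists l, cdiff f z l.
  by move=> zr zi; exists (f^`() z)%classic; apply: derivable_cdiff; exact: fder.
pose F := fclamp s f.
have cF : sedge_continuous r F by apply: continuous_edge; exact: (fclamp_continuous r0 rs fd).
have c1 : sedge_continuous r (fun=> 1 : Cplx R).
  by apply: continuous_edge; exact: cst_continuous.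
pose K : Cplx R -> Cplx R := ctransform r 1 (fun=> 1); pose L : Cplx R -> Cplx R := ctransform r 1 F.
pose K' : Cplx R -> Cplx R := ctransform r 2 (fun=> 1); pose L' : Cplx R -> Cplx R := ctransform r 2 F.
have dK w : inside r w -> cdiff K w (K' w) by exact: (ctransform_cdiff1 r0 c1).
have dL w : inside r w -> cdiff L w (L' w) by exact: (ctransform_cdiff1 r0 cF).
have fKL w : inside r w -> f w * K w = L w by move=> iw; exact: (cauchy_square r0 rs fd iw).
have eqn w : inside r w -> f w * K' w + K w * f^`()%classic w = L' w.
  move=> iw; have /andP[wr wi] := iw.
  have /is_derive_cdiff dfw := derivable_cdiff (fder w (ltW (lt_trans wr rs)) (ltW (lt_trans wi rs))).
  have /is_derive_cdiff dKw := dK w iw.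
  have /is_derive_cdiff := is_deriveM dfw dKw.
  move/cdiff_unique; apply; apply: (cdiff_near (margin_gt0 iw) _ (dL w iw)).
  by move=> y /inside_near iy; rewrite -fKL.
have i0 := inside0 r0.
have K0 : K 0 != 0 by exact: ctransform1_neq0.
have near_in : (\forall w \near (0 : Cplx R), inside r w /\ K w != 0)%classic.
  have nK : 0 < normc (K 0) by rewrite normc_gt0.
  have /cdiff_continuous /continuousC /(_ _ nK)[t t0 Ht] := dK 0 i0.
  apply/nearC; exists (Num.min (margin r 0) t); first by rewrite lt_min margin_gt0.
  move=> w; rewrite lt_min => /andP[wm wt]; split; first exact: inside_near wm.
  apply/eqP => Kw; have := Ht w wt; rewrite Kw sub0r normcN ltxx //.
have fE : (\forall w \near (0 : Cplx R), f^`()%classic w = (L' w - f w * K' w) * (K w)^-1)%classic.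
  apply: filterS near_in => w [iw Kw]; rewrite -eqn // addrC addKr.
  by rewrite mulrAC divff // mul1r.
have derf : derivable f 0 1 by apply: fder => /=; rewrite normr0 ltW.
have derK : derivable K 0 1 by apply: cdiff_derivable (dK 0 i0).
have derK' : derivable K' 0 1 by apply: cdiff_derivable (ctransform_cdiff2 r0 c1 i0).
have derL' : derivable L' 0 1 by apply: cdiff_derivable (ctransform_cdiff2 r0 cF i0).
have /derivable_cdiff D : derivable (fun w : Cplx R => (L' w - f w * K' w) * (K w)^-1 : Cplx R) 0 1.
  apply: derivableM; last exact: (derivableV K0 derK).
  by apply: derivableB; [exact: derL'|exact: derivableM derf derK'].
have /nearC[t t0 Ht] := fE.
exact: cdiff_derivable (cdiff_near t0 Ht D).
Qed.

(** Translation moves [a] to 0, where the contours are centred. *)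
Lemma derivable_derive1 f a : holo_near f a -> derivable (f^`())%classic a 1.
Proof.
move=> /nearC[d d0 Hd].
have sh z l g b : cdiff g (b + z) l <-> cdiff (fun y => g (b + y)) z l.
  by split=> H e /H[t t0 Ht]; exists t => // h /Ht; rewrite !addrA.
pose g (z : Cplx R) : Cplx R := f (a + z).
have gd z : normc z < d -> derivable g z 1 /\ (g^`() z = f^`() (a + z))%classic.
  move=> zd; have /derivable_cdiff /sh H : derivable f (a + z) 1 by apply: Hd; rewrite addrC addKr.
  split; first exact: cdiff_derivable H.
  have /is_derive_cdiff H' := H; rewrite derive1E; exact: derive_val.
have gh : holo_near g 0.
  by apply/nearC; exists d => // z; rewrite subr0 => /gd[].
have /derivable_cdiff H := derivable_derive1_at0 gh.
apply: (@cdiff_derivable _ _ _ (g^`()^`() 0)%classic).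
rewrite -[a]addr0; apply/sh; apply: (cdiff_near d0 _ H).
by move=> y; rewrite subr0 => /gd[_ ->].
Qed.

Lemma holo_near_open f (a : Cplx R) : holo_near f a -> \forall z \near a, holo_near f z.
Proof. by move=> /nbhs_interior. Qed.

Lemma holo_near_derive1 f (a : Cplx R) : holo_near f a -> holo_near (f^`())%classic a.
Proof. by move=> /holo_near_open; apply: filterS => z; exact: derivable_derive1. Qed.

End HolomorphicDerivative.

(** * Sums over ordered set partitions as a recursion on the used set *)

Section OrderedPartitionSums.
Variables (K : comNzRingType) (T : finType).
Variable F : {set T} -> {set T} -> K.
Implicit Types (top U B : {set T}).

(** Sum over the ways to grow [U] to [top] by [l] successive nonempty blocks, each weighted
    according to what precedes it. A variable [top] makes it possible to leave one index out
    altogether. *)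
Fixpoint chain_sum top (l : nat) U : K :=
  if l is l'.+1 then
    \sum_(B : {set T} | (B != finset.set0) && (B \subset top :\: U))
      F U B * chain_sum top l' (U :|: B)
  else (U == top)%:R.

Definition chains top U : K := \sum_(l < #|T|.+1) chain_sum top l U.

Lemma chain_sum_oversize top l U : U \subset top -> (#|top :\: U| < l)%N ->
  chain_sum top l U = 0.
Proof.
elim: l U => // l IH U sU lU /=.
apply: big1 => B /andP[B0 sB]; rewrite IH ?mulr0 //.
  by rewrite finset.subUset sU (fintype.subset_trans sB) // finset.subsetDl.
have sub : top :\: (U :|: B) \proper top :\: U.
  rewrite fintype.properE finset.setDS ?finset.subsetUl //=; have /finset.set0Pn[x xB] := B0.
  apply/subsetPn; exists x; first exact: (fintype.subsetP sB).
  by rewrite !inE xB orbT.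
exact: leq_trans (proper_card sub) lU.
Qed.

(** Appending the length [#|T|.+1], whose sum vanishes by [chain_sum_oversize], makes room for
    splitting off the first block. *)
Lemma chainsE top U : U \subset top ->
  chains top U = (U == top)%:R +
    \sum_(B : {set T} | (B != finset.set0) && (B \subset top :\: U)) F U B * chains top (U :|: B).
Proof.
move=> sU.
have -> : chains top U = \sum_(l < #|T|.+2) chain_sum top l U.
  rewrite [RHS]big_ord_recr [X in _ = _ + X]chain_sum_oversize ?addr0 //.
  by rewrite ltnS max_card.
rewrite big_ord_recl /=; congr (_ + _).
rewrite exchange_big /=; apply: eq_bigr => B _.
by rewrite /chains mulr_sumr.
Qed.

Lemma chains_top top : chains top top = 1.
Proof.
rewrite chainsE // eqxx big1 ?addr0 // => B /andP[B0].
by rewrite finset.setDv finset.subset0 (negbTE B0).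
Qed.

Definition is_comp_above U l (g : {ffun 'I_l -> {set T}}) : bool :=
  [forall i, g i != finset.set0] &&
  [forall i, forall j, (i != j) ==> [disjoint g i & g j]] &&
  (\bigcup_(i < l) g i == ~: U).

Definition blocks_before l (g : {ffun 'I_l -> {set T}}) (i : 'I_l) : {set T} :=
  \bigcup_(k < l | (k < i)%N) g k.

Definition cons_block l (p : {set T} * {ffun 'I_l -> {set T}}) : {ffun 'I_l.+1 -> {set T}} :=
  [ffun i => if unlift ord0 i is Some j then p.2 j else p.1].

Definition uncons_block l (g : {ffun 'I_l.+1 -> {set T}}) : {set T} * {ffun 'I_l -> {set T}} :=
  (g ord0, [ffun j => g (lift ord0 j)]).

Lemma cons_blockK l : cancel (@cons_block l) (@uncons_block l).
Proof.
case=> B g; rewrite /uncons_block /cons_block ffunE unlift_none /=; congr pair.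
by apply/ffunP => j; rewrite !ffunE liftK.
Qed.

Lemma uncons_blockK l : cancel (@uncons_block l) (@cons_block l).
Proof.
move=> g; apply/ffunP => i; rewrite ffunE /=.
by case: unliftP => [j ->|->]; rewrite ?ffunE.
Qed.

Lemma cons_block0 l p : @cons_block l p ord0 = p.1.
Proof. by rewrite ffunE unlift_none. Qed.

Lemma cons_blockS l p j : @cons_block l p (lift ord0 j) = p.2 j.
Proof. by rewrite ffunE liftK. Qed.

Lemma is_comp_above_cons l U B (g : {ffun 'I_l -> {set T}}) :
  is_comp_above U (cons_block (B, g)) =
  (B != finset.set0) && (B \subset finset.setT :\: U) && is_comp_above (U :|: B) g.
Proof.
rewrite /is_comp_above big_ord_recl cons_block0 /=.
under eq_bigr => i _ do rewrite cons_blockS /=.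
set V := \bigcup_(i < l) g i.
apply/andP/andP => [[/andP[/forallP n0 /forallP dj] /eqP cov]|
  [/andP[B0 sB] /andP[/andP[/forallP n0 /forallP dj] /eqP cov]]].
  have BV x : x \in B -> x \notin V.
    move=> xB; apply/negP => /bigcupP[j _ xj].
    have /forallP /(_ (lift ord0 j)) := dj ord0.
    rewrite neq_lift cons_block0 cons_blockS /= finset.disjoints_subset => /fintype.subsetP /(_ x xB).
    by rewrite inE xj.
  split.
    have := n0 ord0; rewrite cons_block0 /= => -> /=; rewrite finset.setTD -cov; exact: finset.subsetUl.
  apply/andP; split.
    apply/andP; split.
      by apply/forallP => j; have := n0 (lift ord0 j); rewrite cons_blockS.
    apply/forallP => i; apply/forallP => j; apply/implyP => ij.
    have /forallP /(_ (lift ord0 j)) := dj (lift ord0 i).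
    by rewrite !cons_blockS (inj_eq lift_inj) ij.
  apply/eqP/setP => x; move/setP: cov => /(_ x); rewrite !inE negb_or.
  by have := BV x; case: (x \in B) => [/(_ isT) /negbTE -> /=|_ /= ->]; rewrite ?andbF ?andbT.
split.
  apply/andP; split.
    apply/forallP => i; case: (unliftP ord0 i) => [j ->|->].
      by rewrite cons_blockS; exact: n0.
    by rewrite cons_block0.
  have BV j : [disjoint B & g j].
    rewrite disjoint_sym finset.disjoints_subset; apply/fintype.subsetP => x xj.
    have : x \in V by apply/bigcupP; exists j.
    by rewrite cov !inE negb_or => /andP[].
  apply/forallP => i; apply/forallP => j; apply/implyP.
  case: (unliftP ord0 i) => [i' ->|->]; case: (unliftP ord0 j) => [j' ->|->].
  - by rewrite !cons_blockS (inj_eq lift_inj); move/forallP: (dj i') => /(_ j') /implyP.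
  - by rewrite cons_blockS cons_block0 disjoint_sym => _; exact: BV.
  - by rewrite cons_blockS cons_block0 => _; exact: BV.
  - by rewrite eqxx.
rewrite cov; apply/eqP/setP => x; rewrite !inE negb_or.
move/fintype.subsetP: sB => /(_ x); rewrite !inE andbT.
by case: (x \in B) => [/(_ isT) ->|_]; rewrite /= ?andbT.
Qed.

(** Induction on the number of blocks: the bijection [cons_block] peels off the first one, which
    joins [U] for all later blocks. *)
Lemma chain_sumE l U :
  \sum_(g : {ffun 'I_l -> {set T}} | is_comp_above U g)
    \prod_(i < l) F (U :|: blocks_before g i) (g i) = chain_sum finset.setT l U.
Proof.
elim: l U => [|l IH] U /=.
  pose g0 : {ffun 'I_0 -> {set T}} := [ffun=> finset.set0].
  have gE (g : {ffun 'I_0 -> {set T}}) : g = g0 by apply/ffunP; case.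
  rewrite big_mkcond (bigD1 g0) //= [X in _ + X]big1 ?addr0 => [|g]; last by rewrite (gE g) eqxx.
  rewrite /is_comp_above !big_ord0 (_ : [forall i, _] = true); last by apply/forallP; case.
  rewrite (_ : [forall i, _] = true) /=; last by apply/forallP; case.
  by rewrite eq_sym -finset.setCT (inj_eq (inv_inj (@finset.setCK T))); case: ifP.
rewrite (reindex (@cons_block l)) /=; last first.
  by exists (@uncons_block l) => x _; [exact: cons_blockK|exact: uncons_blockK].
under [RHS]eq_bigr => B _ do rewrite -IH mulr_sumr.
rewrite pair_big_dep /=; apply: eq_big => [[B g]|[B g] _]; first exact: is_comp_above_cons.
rewrite big_ord_recl cons_block0 /blocks_before big_pred0_eq finset.setU0 /=.
congr (_ * _); apply: eq_bigr => i _; rewrite cons_blockS /=; congr (F _ _).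
rewrite -finset.setUA; congr (_ :|: _).
rewrite big_mkcond big_ord_recl cons_block0 /=; congr (_ :|: _).
by rewrite [RHS]big_mkcond; apply: eq_bigr => k _; rewrite cons_blockS.
Qed.

End OrderedPartitionSums.

(** * Calculus rules, l'Hopital's rule and the quotients f^(k)/f *)

Section ComplexCalculus.
Variable R : realType.
Implicit Types (f g : Cplx R -> Cplx R) (z w l : Cplx R).

Lemma cdiff_cst (k : Cplx R) z : cdiff (fun=> k) z 0.
Proof. by apply/is_derive_cdiff; exact: is_derive_cst. Qed.

Lemma cdiff_id z : cdiff (fun x => x) z 1.
Proof. by apply/is_derive_cdiff; exact: is_derive_id. Qed.

Lemma cdiffD f g z l l' : cdiff f z l -> cdiff g z l' ->
  cdiff (fun x => f x + g x) z (l + l').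
Proof. by move=> /is_derive_cdiff ? /is_derive_cdiff ?; apply/is_derive_cdiff; exact: is_deriveD. Qed.

Lemma cdiffM f g z l l' : cdiff f z l -> cdiff g z l' ->
  cdiff (fun x => f x * g x) z (f z * l' + g z * l).
Proof. by move=> /is_derive_cdiff ? /is_derive_cdiff ?; apply/is_derive_cdiff; exact: is_deriveM. Qed.

Lemma cdiffN f z l : cdiff f z l -> cdiff (fun x => - f x) z (- l).
Proof. by move=> /is_derive_cdiff ?; apply/is_derive_cdiff; exact: is_deriveN. Qed.

Lemma cdiffV f z l : f z != 0 -> cdiff f z l -> cdiff (fun x => (f x)^-1) z (- (f z ^- 2) * l).
Proof.
move=> fz /is_derive_cdiff [df <-]; apply/is_derive_cdiff; split; first exact: derivableV.
by rewrite deriveV.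
Qed.

Lemma cdiff_sum (I : Type) (r : seq I) (P : pred I) (F : I -> Cplx R -> Cplx R)
    (dF : I -> Cplx R) z : (forall i, P i -> cdiff (F i) z (dF i)) ->
  cdiff (fun x => \sum_(i <- r | P i) F i x) z (\sum_(i <- r | P i) dF i).
Proof.
move=> HF; elim: r => [|i r IH].
  rewrite big_nil (_ : (fun x => _) = (fun=> 0)); first exact: cdiff_cst.
  by apply/funext => x; rewrite big_nil.
rewrite big_cons (_ : (fun x => _) =
    (fun x => if P i then F i x + \sum_(j <- r | P j) F j x else \sum_(j <- r | P j) F j x)).
  by have := HF i; case: (P i) => [/(_ isT) Hi|_]; [exact: cdiffD Hi IH|exact: IH].
by apply/funext => x; rewrite big_cons.
Qed.

Lemma cvgC_sum (X : Type) (F : set_system X) {FF : Filter F} (I : Type) (r : seq I)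
    (P : pred I) (g : I -> X -> Cplx R) (l : I -> Cplx R) :
  (forall i, P i -> (g i @ F --> l i)%classic) ->
  ((fun x => \sum_(i <- r | P i) g i x) @ F --> \sum_(i <- r | P i) l i)%classic.
Proof.
move=> Hg; elim: r => [|i r IH].
  rewrite big_nil; have -> : (fun x => \sum_(i <- [::] | P i) g i x) = (fun=> 0).
    by apply/funext => x; rewrite big_nil.
  exact: cvg_cst.
have -> : (fun x => \sum_(j <- i :: r | P j) g j x) =
    (fun x => if P i then g i x + \sum_(j <- r | P j) g j x else \sum_(j <- r | P j) g j x).
  by apply/funext => x; rewrite big_cons.
rewrite big_cons.
by have := Hg i; case: (P i) => [/(_ isT) Hi|_]; [exact: (cvgD Hi IH)|exact: IH].
Qed.

Lemma cdiff_lipschitz f z l : cdiff f z l ->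
  exists2 d : R, 0 < d & forall h, normc h < d ->
    normc (f (z + h) - f z) <= (normc l + 1) * normc h.
Proof.
move=> /(_ 1 ltr01)[d d0 Hd]; exists d => // h hd.
have -> : f (z + h) - f z = (f (z + h) - f z - l * h) + l * h by rewrite subrK.
apply: (le_trans (le_normcD _ _)); rewrite normcM mulrDl addrC lerD2l; exact: Hd.
Qed.

Lemma cdiff_comp f g z l l' : cdiff f z l -> cdiff g (f z) l' ->
  cdiff (fun x => g (f x)) z (l' * l).
Proof.
move=> df dg e e0; have [d1 d10 H1] := cdiff_lipschitz df.
pose c := normc l + 1; have c0 : 0 < c by rewrite ltr_wpDl // normc_ge0.
have l'0 : 0 < normc l' + 1 by rewrite ltr_wpDl // normc_ge0.
have e1 : 0 < e / (2 * c) by rewrite divr_gt0 // mulr_gt0.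
have e2 : 0 < e / (2 * (normc l' + 1)) by rewrite divr_gt0 // mulr_gt0.
have [d2 d20 H2] := dg _ e1; have [d3 d30 H3] := df _ e2.
exists (Num.min (Num.min d1 d3) (d2 / c)); first by rewrite !lt_min d10 d30 divr_gt0.
move=> h; rewrite !lt_min => /andP[/andP[hd1 hd3] hd2].
pose k := f (z + h) - f z.
have kh : normc k <= c * normc h by exact: H1.
have kd : normc k < d2 by apply: (le_lt_trans kh); rewrite mulrC -ltr_pdivlMr.
have := H2 _ kd; have -> : f z + k = f (z + h) by rewrite addrC subrK.
move=> G2; have G3 := H3 _ hd3.
have -> : g (f (z + h)) - g (f z) - l' * l * h =
    (g (f (z + h)) - g (f z) - l' * k) + l' * (f (z + h) - f z - l * h) by rewrite /k; ring.
apply: (le_trans (le_normcD _ _)); rewrite normcM (splitr e) mulrDl; apply: lerD.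
  apply: (le_trans G2).
  have -> : e / 2 * normc h = e / (2 * c) * (c * normc h) by field; rewrite gt_eqF.
  by rewrite ler_wpM2l // ltW.
apply: (@le_trans _ _ ((normc l' + 1) * (e / (2 * (normc l' + 1)) * normc h))).
  by rewrite ler_pM ?normc_ge0 // lerDl.
by rewrite le_eqVlt; apply/orP; left; apply/eqP; field; rewrite gt_eqF.
Qed.

(** Dividing numerator and denominator by [x - z] turns both into difference quotients. *)
Lemma lhopital_simple_zero f g z l l' : f z = 0 -> g z = 0 ->
  cdiff f z l -> cdiff g z l' -> l' != 0 ->
  (f x / g x @[x --> z^'] --> l / l')%classic.
Proof.
move=> f0 g0 df dg l'0.
have Q (h : Cplx R -> Cplx R) (k : Cplx R) : h z = 0 -> cdiff h z k ->
    ((fun x => (x - z)^-1 * h x : Cplx R) @ z^' --> k)%classic.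
  move=> h0 dh; apply/cvgC => e e0; rewrite near_withinE; apply/nearC.
  have e2 : 0 < e / 2 by rewrite divr_gt0.
  have [d d0 Hd] := dh _ e2; exists d => // x xd xz.
  have := Hd _ xd; have -> : z + (x - z) = x by rewrite addrC subrK.
  rewrite h0 subr0 => H.
  have nxz : 0 < normc (x - z) by rewrite normc_gt0 subr_eq0.
  rewrite -(ltr_pM2r nxz) -normcM.
  apply: (@le_lt_trans _ _ (e / 2 * normc (x - z))).
    have -> // : ((x - z)^-1 * h x - k) * (x - z) = h x - k * (x - z).
    by rewrite mulrBl [_ * h x]mulrC mulfVK // subr_eq0.
  by rewrite ltr_pM2r // ltr_pdivrMr // ltr_pMr // ltrDl.
have C : ((fun x => ((x - z)^-1 * f x) * ((x - z)^-1 * g x)^-1 : Cplx R) @ z^' --> l / l')%classic.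
  exact: (cvgM (Q f l f0 df) (cvgV l'0 (Q g l' g0 dg))).
apply: (cvg_trans _ C); apply: near_eq_cvg; rewrite near_withinE.
apply/nearC; exists 1 => // x _ xz.
have xz0 : x - z != 0 by rewrite subr_eq0.
rewrite /= invfM invrK mulrACA.
by rewrite mulVf // mul1r.
Qed.

(** Each step uses [holo_near_derive1]; Cauchy's formula enters here. *)
Lemma holo_near_theta_pow f (a : Cplx R) k : holo_near f a -> holo_near (theta_pow k f) a.
Proof.
move=> hf; elim: k => [|k IH]; first exact: hf.
have := holo_near_derive1 IH; apply: filterS => z D.
exact: (derivableM (@derivable_id _ _ z 1) D).
Qed.

Lemma theta_pow_cdiff f (a : Cplx R) k : holo_near f a ->
  cdiff (theta_pow k f) a (derive1 (theta_pow k f) a).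
Proof.
move=> hf; apply: derivable_cdiff.
exact: (nbhs_singleton (holo_near_theta_pow k hf)).
Qed.

Definition log_theta f k (y : Cplx R) : Cplx R := theta_pow k f y / f y.

Lemma log_theta_cdiff f (a : Cplx R) k : holo_near f a -> f a != 0 ->
  exists2 l, cdiff (log_theta f k) a l &
    a * l = log_theta f k.+1 a - log_theta f 1 a * log_theta f k a.
Proof.
move=> hf fa; have d1 := theta_pow_cdiff k hf; have d0 := theta_pow_cdiff 0 hf.
eexists; first exact: cdiffM d1 (cdiffV fa d0).
have E1 : theta_pow k.+1 f a = a * derive1 (theta_pow k f) a by exact: erefl.
have E2 : theta_pow 1 f a = a * derive1 (theta_pow 0 f) a by exact: erefl.
have alg (K : fieldType) (x u v w y : K) : y != 0 ->
    x * (u * (- y ^- 2 * v) + y^-1 * w) = x * w / y - x * v / y * (u / y).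
  by move=> y0; field.
rewrite /log_theta E1 E2; exact: alg.
Qed.

End ComplexCalculus.

(** * [Phi] as a sum over chains *)

Section PhiAsChains.
Variable R : realType.

(** [i0] will be the first index and [B] the trace of the next block on the others; the block
    [[set i0]] has empty trace and stands apart. *)
Lemma sum_split_point (K : comNzRingType) (T : finType) (i0 : T) (V : {set T}) (G : {set T} -> K) :
  i0 \notin V ->
  \sum_(B : {set T} | (B != finset.set0) && (B \subset finset.setT :\: V)) G B =
  \sum_(B : {set T} | (B != finset.set0) && (B \subset ~: [set i0] :\: V)) (G B + G (i0 |: B)) +
  G [set i0].
Proof.
move=> i0V; rewrite (bigID (fun B : {set T} => i0 \in B)) /= addrC big_split /= -addrA.
congr (_ + _).
  apply: eq_bigl => B; rewrite -andbA; congr (_ && _).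
  apply/andP/fintype.subsetP => [[/fintype.subsetP sB i0B] x xB|sB].
    rewrite !inE; have := sB x xB; rewrite !inE andbT => ->; rewrite andTb.
    by apply: contraNneq i0B => <-.
  split; last by apply/negP => /sB; rewrite !inE eqxx andbF.
  by apply/fintype.subsetP => x /sB; rewrite !inE => /andP[->].
rewrite (reindex_onto (fun B : {set T} => i0 |: B) (fun B => B :\ i0)) /=; last first.
  by move=> B /andP[_ i0B]; rewrite finset.setD1K.
rewrite (eq_bigl (fun B : {set T} => B \subset ~: [set i0] :\: V)); last first.
  move=> B; apply/andP/fintype.subsetP => [[/andP[/andP[_ /fintype.subsetP sB] _] /eqP BE] x xB|sB].
    rewrite !inE; have := sB x; rewrite !inE xB orbT andbT => /(_ isT) ->; rewrite andTb.
    by apply/eqP => xi; move: xB; rewrite -BE xi !inE eqxx.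
  have i0B : i0 \notin B by apply/negP => /sB; rewrite !inE eqxx andbF.
  split; last by rewrite finset.setU1K.
  rewrite finset.setU11 andbT; apply/andP; split.
    by apply/finset.set0Pn; exists i0; rewrite finset.setU11.
  apply/fintype.subsetP => x; rewrite !inE => /orP[/eqP ->|/sB]; first by rewrite i0V.
  by rewrite !inE => /andP[->].
rewrite (bigD1 finset.set0) /=; last exact: finset.sub0set.
by rewrite finset.setU0 addrC; congr (_ + _); apply: eq_bigl => B; rewrite andbC.
Qed.

(* The sign [(-1)^l] is shared out among the [l] blocks; [U] is the union of the
   blocks before [B], so [U = set0] singles out the first one. *)
Definition weight (f : Cplx R -> Cplx R) n (t : 'I_n -> Cplx R) (U B : {set 'I_n}) : Cplx R :=
  - (if U == finset.set0 then theta_pow #|B| f 1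
     else log_theta f #|B| (\prod_(j in U) t j)).

Lemma Phi_chains (f : Cplx R -> Cplx R) n (t : 'I_n -> Cplx R) : (0 < n)%N ->
  Phi f t = chains (weight f t) finset.setT finset.set0.
Proof.
move=> n0; have nT : (finset.set0 == [set: 'I_n]) = false.
  by apply/negbTE/eqP => /setP /(_ (Ordinal n0)); rewrite !inE.
(* [Phi] counts blocks minus one. The additional term of [chains] is the one without blocks, which
   is 0 because [n > 0]. *)
rewrite /chains card_ord big_ord_recl /= nT add0r /Phi; apply: eq_bigr => l _.
rewrite -[RHS]/(chain_sum (weight f t) finset.setT l.+1 finset.set0) -chain_sumE.
apply: eq_big => [g|g /andP[/andP[/forallP g0 _] _]].
  by rewrite /is_comp_above finset.setC0.
rewrite [X in _ * X]big_mkcond !big_ord_recl /= mul1r.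
rewrite /blocks_before [X in finset.set0 :|: X]big_pred0_eq finset.setU0 /weight eqxx.
have -> : \prod_(i < l) - (if finset.set0 :|: \bigcup_(k < l.+1 | (k < lift ord0 i)%N) g k == finset.set0
      then theta_pow #|g (lift ord0 i)| f 1
      else log_theta f #|g (lift ord0 i)|
        (\prod_(j in finset.set0 :|: \bigcup_(k < l.+1 | (k < lift ord0 i)%N) g k) t j)) =
   (-1) ^+ l * \prod_(i < l) log_theta f #|g (lift ord0 i)| (\prod_(j in upsilon g (lift ord0 i)) t j).
  rewrite prodrN card_ord; congr (_ * _); apply: eq_bigr => i _.
  (* Later blocks fall in the second branch of [weight]: the set before them contains the nonempty
     first block. *)
  rewrite finset.set0U -/(upsilon g (lift ord0 i)) ifF //; apply/negbTE.
  have /finset.set0Pn[x xg] := g0 ord0.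
  by apply/finset.set0Pn; exists x; apply/bigcupP; exists ord0.
by rewrite exprS; ring.
Qed.

End PhiAsChains.

(** * Recursions along the path and regularity at [x = 1] *)

Section TorusPath.
Variables (R : realType) (f : Cplx R -> Cplx R) (n : nat) (s : 'I_n -> Cplx R).
Hypothesis n2 : (2 <= n)%N.
Hypothesis s0 : forall j : 'I_n, val j = 0%N -> s j = 1.
Hypothesis sprod : \prod_(j < n) s j = 1.
Implicit Types (V B : {set 'I_n}).

Definition first_index : 'I_n := Ordinal (ltnW n2).
Local Notation i0 := first_index.
Local Notation N := (~: [set i0]).

Let nlast : (n.-1 < n)%N. Proof. by rewrite ltn_predL ltnW. Qed.
Definition last_index : 'I_n := Ordinal nlast.

Lemma tail_indices : [set j : 'I_n | (0 < val j)%N] = N.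
Proof. by apply/setP => j; rewrite !inE lt0n. Qed.

Lemma sub_tail_notin V : V \subset N -> i0 \notin V.
Proof. by move=> /fintype.subsetP sV; apply/negP => /sV; rewrite !inE eqxx. Qed.

Lemma last_index_tail : last_index \in N.
Proof. by rewrite !inE -val_eqE /= -lt0n -subn1 subn_gt0. Qed.

Definition tprod V (x : Cplx R) : Cplx R := \prod_(j in V) tpath s x j.
Definition sprod_on V : Cplx R := \prod_(j in V) s j.

Lemma tprodE V x : i0 \notin V ->
  tprod V x = sprod_on V * (if last_index \in V then x^-1 else 1).
Proof.
move=> iV; have -> : tprod V x = \prod_(j in V) (s j * (if j == last_index then x^-1 else 1)).
  apply: eq_bigr => j jV; rewrite /tpath ifF; last first.
    by apply/negbTE; apply: contraNneq iV => j0; rewrite (_ : i0 = j) //; apply: val_inj.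
  by rewrite -val_eqE /=; case: ifP => // _; rewrite mulr1.
rewrite big_split /=; congr (_ * _); case: ifP => lV.
  by rewrite (bigD1 last_index) //= eqxx big1 ?mulr1 // => j /andP[_ /negbTE ->].
by rewrite big1 // => j jV; case: eqP => // jl; rewrite -jl jV in lV.
Qed.

Lemma tprod1 V : i0 \notin V -> tprod V 1 = sprod_on V.
Proof. by move=> iV; rewrite tprodE //; case: ifP; rewrite ?invr1 mulr1. Qed.

Lemma tprod_cdiff V : i0 \notin V -> exists l, cdiff (tprod V) 1 l.
Proof.
move=> iV; have -> : tprod V = (fun x => sprod_on V * (if last_index \in V then x^-1 else 1)).
  by apply/funext => x; exact: tprodE.
case: (last_index \in V); eexists.
  by apply: cdiffM; [exact: cdiff_cst|exact: (cdiffV (oner_neq0 _) (cdiff_id 1))].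
by apply: cdiffM; [exact: cdiff_cst|exact: cdiff_cst].
Qed.

Lemma tprodU V x : i0 \notin V -> tprod (i0 |: V) x = x * tprod V x.
Proof. by move=> iV; rewrite /tprod big_setU1 //= {1}/tpath eqxx. Qed.

(** As [s] is 1 at the first index, its other values multiply to 1, and the last coordinate brings
    [x^-1]: this is the source of the second pole. *)
Lemma tprod_tail x : tprod N x = x^-1.
Proof.
have iN : i0 \notin N by rewrite !inE eqxx.
rewrite tprodE // last_index_tail (_ : sprod_on N = 1) ?mul1r //.
rewrite -sprod (bigD1 i0) //= s0 // mul1r /sprod_on; apply: eq_bigl => j.
by rewrite !inE.
Qed.

Local Notation L := (log_theta f).
Local Notation wt x := (weight f (tpath s x)).

(* The orders of summation after the blocks used so far: [chainP] starts with
   index 0 already used, [chainQ] omits it altogether, and [chainR] is the part of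
   [chainW] left after its polar part at [x = 1] has been removed. *)
Definition chainP V x : Cplx R := chains (wt x) finset.setT (i0 |: V).
Definition chainQ V x : Cplx R := chains (wt x) N V.
Definition chainW V x : Cplx R := chains (wt x) finset.setT V.
Definition chainR V x : Cplx R := chainW V x + L 1 x^-1 * chainQ V x.

Lemma chainPE V x : V \subset N -> chainP V x = (V == N)%:R +
  \sum_(B : {set 'I_n} | (B != finset.set0) && (B \subset N :\: V))
    - L #|B| (x * tprod V x) * chainP (V :|: B) x.
Proof.
move=> sV; have iV := sub_tail_notin sV.
rewrite /chainP chainsE ?finset.subsetT //; congr (_%:R + _).
  congr nat_of_bool; apply/eqP/eqP => [E|->]; last by rewrite finset.setUCr.
  apply/setP => j; move/setP: E => /(_ j); rewrite !inE.
  by case: eqP => [->|] //=; rewrite (negbTE iV).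
have -> : finset.setT :\: (i0 |: V) = N :\: V.
  by apply/setP => j; rewrite !inE negb_or andbT andbC.
apply: eq_bigr => B _; rewrite /weight ifF; last first.
  by apply/negbTE/finset.set0Pn; exists i0; rewrite finset.setU11.
by rewrite -/(tprod _ _) tprodU // finset.setUA.
Qed.

(** A nonempty [V] puts [weight] in its second branch; in [chainPE] the presence of [i0] does so. *)
Lemma chainQE V x : V != finset.set0 -> V \subset N -> chainQ V x = (V == N)%:R +
  \sum_(B : {set 'I_n} | (B != finset.set0) && (B \subset N :\: V))
    - L #|B| (tprod V x) * chainQ (V :|: B) x.
Proof.
move=> V0 sV; rewrite /chainQ chainsE //; congr (_ + _).
by apply: eq_bigr => B _; rewrite /weight (negbTE V0).
Qed.

(** The next block avoids [i0], contains it among others, which raises the order of the derivative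
    by one, or is [[set i0]]; in the last two cases [chainP] takes over. *)
Lemma chainWE V x : V != finset.set0 -> V \subset N -> chainW V x =
  \sum_(B : {set 'I_n} | (B != finset.set0) && (B \subset N :\: V))
    (- L #|B| (tprod V x) * chainW (V :|: B) x +
     - L #|B|.+1 (tprod V x) * chainP (V :|: B) x) +
  - L 1 (tprod V x) * chainP V x.
Proof.
move=> V0 sV; have iV := sub_tail_notin sV.
rewrite /chainW chainsE ?finset.subsetT // (_ : (V == _) = false); last first.
  by apply/negbTE/eqP => VT; move: iV; rewrite VT inE.
rewrite add0r (sum_split_point _ iV) /weight (negbTE V0) cards1.
congr (_ + _); last by rewrite finset.setUC.
apply: eq_bigr => B /andP[_ sB]; congr (_ + _).
rewrite cardsU1 (_ : i0 \notin B) ?add1n; last first.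
  by apply/negP => /(fintype.subsetP sB); rewrite !inE eqxx andbF.
by rewrite finset.setUCA.
Qed.

(** [chainW] and [chainQ] have recursions with the same coefficients on later terms, so [chainR]
    satisfies one in which the singular factor [L 1 x^-1] no longer appears. *)
Lemma chainRE V x : V != finset.set0 -> V \subset N -> V != N -> chainR V x =
  \sum_(B : {set 'I_n} | (B != finset.set0) && (B \subset N :\: V))
    (- L #|B| (tprod V x) * chainR (V :|: B) x +
     - L #|B|.+1 (tprod V x) * chainP (V :|: B) x) +
  - L 1 (tprod V x) * chainP V x.
Proof.
move=> V0 sV VN; rewrite /chainR chainWE // chainQE // (negbTE VN) add0r.
rewrite addrAC mulr_sumr -big_split /=; congr (_ + _); apply: eq_bigr => B _.
have alg (K : comNzRingType) (a w b p c q : K) :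
  a * w + b * p + c * (a * q) = a * (w + c * q) + b * p by ring.
exact: alg.
Qed.

(** Once [N] is used only [[set i0]] remains, with weight [- L 1 x^-1]: here [chainW] is entirely
    polar. *)
Lemma chainR_tail x : chainR N x = 0.
Proof.
have N0 : N != finset.set0 by apply/finset.set0Pn; exists last_index; exact: last_index_tail.
rewrite /chainR chainWE // big1 => [|B /andP[B0]]; last first.
  by rewrite finset.setDv finset.subset0 (negbTE B0).
rewrite tprod_tail add0r /chainP /chainQ chains_top finset.setUCr chains_top.
by rewrite !mulr1 addNr.
Qed.

(** The inductive step of P' - Q' = R at [x = 1], with [i] running over blocks: [t] is the product
    over the used set, [dt] its derivative, and [h], [dh], [h'] are a [log_theta], its derivative
    and the [log_theta] of next order. P is evaluated at [x t], whose derivative exceeds [dt] by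
    [t]; the hypothesis rewrites the surplus [t * dh]. *)
Lemma telescoping_identity (K : comNzRingType) (I : finType) (S : pred I)
    (h p dp dq dh h' : I -> K) (dt t h1 : K) :
  (forall i, S i -> t * dh i = h' i - h1 * h i) ->
  \sum_(i | S i) (- h i * dp i + p i * - (dh i * (1 * dt + t * 1))) -
    \sum_(i | S i) (- h i * dq i + p i * - (dh i * dt)) =
  \sum_(i | S i) (- h i * (dp i - dq i) + - h' i * p i) +
    - h1 * \sum_(i | S i) - h i * p i.
Proof.
move=> E; rewrite mulr_sumr -big_split -sumrB /=; apply: eq_bigr => i Si.
have -> : h' i = t * dh i + h1 * h i by rewrite E // subrK.
by ring.
Qed.

(** The induction invariant. Equality of values removes the pole of [Phi_term]; the last clause
    identifies the finite part left behind. *)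
Definition chain_regular V := exists dp dq,
  [/\ cdiff (chainP V) 1 dp, cdiff (chainQ V) 1 dq, chainP V 1 = chainQ V 1,
      {for 1, continuous (chainR V)} & dp - dq = chainR V 1].

Hypothesis sreg : forall V, V != finset.set0 -> V \subset N -> V != N ->
  holo_near f (sprod_on V) /\ f (sprod_on V) != 0.

Lemma chain_regular_tail : chain_regular N.
Proof.
have PN : chainP N = (fun=> 1) by apply/funext => x; rewrite /chainP finset.setUCr chains_top.
have QN : chainQ N = (fun=> 1) by apply/funext => x; rewrite /chainQ chains_top.
have RN : chainR N = (fun=> 0) by apply/funext => x; exact: chainR_tail.
exists 0, 0; rewrite PN QN RN subrr; split.
- exact: cdiff_cst.
- exact: cdiff_cst.
- exact: erefl.
- exact: cst_continuous.
- exact: erefl.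
Qed.

(** Induction on the number of indices of [N] outside [V], as every added block enlarges [V]. For
    [V] other than [N], [sreg] makes [f] regular and nonzero at the point [sprod_on V] where
    [log_theta] is differentiated. *)
Lemma chain_regularP V : V != finset.set0 -> V \subset N -> chain_regular V.
Proof.
have [m] := ubnP #|N :\: V|; elim: m V => // m IH V; rewrite ltnS => mV V0 sV.
have [->|VN] := eqVneq V N; first exact: chain_regular_tail.
have iV := sub_tail_notin sV; have [hV fV] := sreg V0 sV VN.
pose inV B := (B != finset.set0) && (B \subset N :\: V).
(* [choice] wants a pair of derivatives for every [B]; sets outside the recursion get a dummy
   one. *)
have /choice[dpq Hdpq] : forall B, exists d : Cplx R * Cplx R, inV B ->
  [/\ cdiff (chainP (V :|: B)) 1 d.1, cdiff (chainQ (V :|: B)) 1 d.2,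
      chainP (V :|: B) 1 = chainQ (V :|: B) 1,
      {for 1, continuous (chainR (V :|: B))} & d.1 - d.2 = chainR (V :|: B) 1].
  move=> B.
  have [/andP[B0 sB]|_] := boolP (inV B); last by exists (0, 0).
  have [|||dp [dq H]] := IH (V :|: B).
  - apply: leq_trans mV; apply: proper_card; rewrite fintype.properE finset.setDS ?finset.subsetUl //=.
    have /finset.set0Pn[x xB] := B0; apply/subsetPn; exists x; first exact: (fintype.subsetP sB).
    by rewrite !inE xB orbT.
  - by apply: contraNneq V0 => E; rewrite -finset.subset0 -E finset.subsetUl.
  - by rewrite finset.subUset sV (fintype.subset_trans sB) // finset.subsetDl.
  by exists (dp, dq).
have /choice[dL HL] : forall k, exists d : Cplx R, cdiff (L k) (sprod_on V) d /\
    sprod_on V * d = L k.+1 (sprod_on V) - L 1 (sprod_on V) * L k (sprod_on V).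
  by move=> k; have [d ? ?] := log_theta_cdiff k hV fV; exists d.
have [l Hl] := tprod_cdiff iV; have t1 := tprod1 iV.
have PE : chainP V = (fun x => \sum_(B | inV B) - L #|B| (x * tprod V x) * chainP (V :|: B) x).
  by apply/funext => x; rewrite chainPE // (negbTE VN) add0r.
have QE : chainQ V = (fun x => \sum_(B | inV B) - L #|B| (tprod V x) * chainQ (V :|: B) x).
  by apply/funext => x; rewrite chainQE // (negbTE VN) add0r.
have Lt k : cdiff (fun x => L k (tprod V x)) 1 (dL k * l).
  by apply: (cdiff_comp Hl); rewrite t1; exact: (HL k).1.
have Lxt k : cdiff (fun x => L k (x * tprod V x)) 1 (dL k * (1 * l + tprod V 1 * 1)).
  by apply: (cdiff_comp (cdiffM (cdiff_id 1) Hl)); rewrite mul1r t1; exact: (HL k).1.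
have P1 : chainP V 1 = \sum_(B | inV B) - L #|B| (sprod_on V) * chainP (V :|: B) 1.
  by rewrite PE; apply: eq_bigr => B _; rewrite mul1r t1.
have dP : cdiff (chainP V) 1 (\sum_(B | inV B) (- L #|B| (1 * tprod V 1) * (dpq B).1 +
    chainP (V :|: B) 1 * - (dL #|B| * (1 * l + tprod V 1 * 1)))).
  rewrite PE; apply: cdiff_sum => B iB; have [H1 _ _ _ _] := Hdpq B iB.
  exact: cdiffM (cdiffN (Lxt #|B|)) H1.
have dQ : cdiff (chainQ V) 1 (\sum_(B | inV B) (- L #|B| (tprod V 1) * (dpq B).2 +
    chainP (V :|: B) 1 * - (dL #|B| * l))).
  rewrite QE; apply: cdiff_sum => B iB; have [_ H1 -> _ _] := Hdpq B iB.
  exact: cdiffM (cdiffN (Lt #|B|)) H1.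
do 2 eexists; split; [exact: dP|exact: dQ|..].
- rewrite P1 QE; apply: eq_bigr => B iB; rewrite t1.
  by have [_ _ -> _ _] := Hdpq B iB.
- have -> : chainR V = (fun x => \sum_(B | inV B)
    (- L #|B| (tprod V x) * chainR (V :|: B) x +
     - L #|B|.+1 (tprod V x) * chainP (V :|: B) x) + - L 1 (tprod V x) * chainP V x).
    by apply/funext => x; exact: chainRE.
  have cL k := cdiff_continuous (cdiffN (Lt k)).
  have cP := cdiff_continuous dP.
  apply: (cvgD _ (cvgM (cL 1%N) cP)); apply: cvgC_sum => B iB.
  have [H1 _ _ H2 _] := Hdpq B iB.
  exact: (cvgD (cvgM (cL #|B|) H2) (cvgM (cL #|B|.+1) (cdiff_continuous H1))).
have -> : chainR V 1 = \sum_(B | inV B)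
    (- L #|B| (sprod_on V) * ((dpq B).1 - (dpq B).2) +
     - L #|B|.+1 (sprod_on V) * chainP (V :|: B) 1) +
    - L 1 (sprod_on V) * \sum_(B | inV B) - L #|B| (sprod_on V) * chainP (V :|: B) 1.
  rewrite (chainRE _ V0 sV VN) t1 P1; congr (_ + _); apply: eq_bigr => B iB.
  by have [_ _ _ _ ->] := Hdpq B iB.
rewrite mul1r t1; apply: telescoping_identity => B _; exact: (HL #|B|).2.
Qed.

End TorusPath.

(** * Consequences of oddness near 1 *)

Section OddFunction.
Variables (R : realType) (f : Cplx R -> Cplx R).
Hypothesis hf : holo_near f 1.
Hypothesis fodd : forall x : Cplx R, x != 0 -> holo_near f x -> holo_near f x^-1 ->
  f x^-1 = - f x.

Let inv_cvg : {for 1, continuous (fun x : Cplx R => x^-1)}.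
Proof. exact: cdiff_continuous (cdiffV (oner_neq0 _) (cdiff_id 1)). Qed.

(** Regularity spreads from 1 to a neighbourhood, and inversion, continuous at 1, keeps [x^-1] in
    it; so the side conditions of [fodd] hold. *)
Lemma near1_odd : \forall x \near (1 : Cplx R),
  [/\ x != 0, derivable f x 1, derivable f x^-1 1 & f x^-1 = - f x].
Proof.
have H1 := holo_near_open hf.
have H2 : \forall x \near (1 : Cplx R), holo_near f x^-1.
  have /nearC[d d0 Hd] := H1; have /continuousC /(_ _ d0)[e e0 He] := inv_cvg.
  apply/nearC; exists e; first exact: e0.
  move=> x xe; apply: Hd; have := He x xe.
  by rewrite invr1.
have H3 : \forall x \near (1 : Cplx R), x != 0.
  apply/nearC; exists 1 => // x; apply: contraTneq => ->.
  by rewrite sub0r normcN normc1 ltxx.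
apply: filterS3 H1 H2 H3 => x h1 h2 h3; split.
- exact: h3.
- exact: (nbhs_singleton h1).
- exact: (nbhs_singleton h2).
- exact: (fodd h3 h1 h2).
Qed.

(** The operator x d/dx changes sign under inversion, so it turns an odd function into an even one.
    Differentiating at [x] needs the relation around [x], hence the passage to the interior. *)
Lemma theta1_even : \forall x \near (1 : Cplx R), theta_pow 1 f x^-1 = theta_pow 1 f x.
Proof.
have /nbhs_interior := near1_odd; apply: filterS => x nx.
have [x0 dfx dfi fi] := nbhs_singleton nx.
have d1 := cdiffV x0 (cdiff_id x).
have d2 := cdiff_comp d1 (derivable_cdiff dfi).
have d3 := cdiffN (derivable_cdiff dfx).
have /nearC[e e0 He] := nx.
have E : cdiff (fun y => f y^-1) x (- derive1 f x).
  by apply: (cdiff_near e0 _ d3) => y /He[].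
have := cdiff_unique d2 E.
have -> : theta_pow 1 f x^-1 = x^-1 * derive1 f x^-1 by exact: erefl.
have -> : theta_pow 1 f x = x * derive1 f x by exact: erefl.
have alg (K : fieldType) (y u v : K) : y != 0 -> u * (- y ^- 2 * 1) = - v -> y^-1 * u = y * v.
  move=> y0 E'; have -> : v = u * y ^- 2.
    by apply: oppr_inj; rewrite -E'; ring.
  by field.
exact: alg.
Qed.

(** Differentiating the evenness of [theta_pow 1 f] at 1 gives [- D = D]. *)
Lemma theta2_at1 : theta_pow 2 f 1 = 0.
Proof.
have d1 := theta_pow_cdiff 1 hf.
have di := cdiffV (oner_neq0 _) (cdiff_id (1 : Cplx R)).
have d1' : cdiff (theta_pow 1 f) 1^-1 (derive1 (theta_pow 1 f) 1) by rewrite invr1.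
have d2 := cdiff_comp di d1'.
have /nearC[e e0 He] := theta1_even.
have E := cdiff_near e0 He d1.
have := cdiff_unique d2 E.
have -> : theta_pow 2 f 1 = 1 * derive1 (theta_pow 1 f) 1 by exact: erefl.
set D := derive1 _ _.
have alg (K : numFieldType) (u : K) : u * (- 1 ^- 2 * 1) = u -> 1 * u = 0.
  rewrite expr1n invr1 !mulr1 mulrN1 => /eqP; rewrite -subr_eq0 -opprD oppr_eq0.
  by rewrite -mulr2n mulrn_eq0 /= => /eqP ->; rewrite mulr0.
exact: (alg _ D).
Qed.

Lemma log_theta1_odd : \forall x \near (1 : Cplx R), log_theta f 1 x^-1 = - log_theta f 1 x.
Proof.
apply: filterS2 theta1_even near1_odd => x E [_ _ _ O].
by rewrite /log_theta E O invrN mulrN.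
Qed.

End OddFunction.

(** * Cancellation of the poles and the limit *)

Section Limit.
Variables (R : realType) (f : Cplx R -> Cplx R) (n : nat) (s : 'I_n -> Cplx R).
Hypothesis n2 : (2 <= n)%N.
Hypothesis s0 : forall j : 'I_n, val j = 0%N -> s j = 1.
Hypothesis sprod : \prod_(j < n) s j = 1.
Hypothesis hf : holo_near f 1.
Hypothesis fodd : forall x : Cplx R, x != 0 -> holo_near f x -> holo_near f x^-1 ->
  f x^-1 = - f x.
Hypothesis f1 : f 1 = 0.
Hypothesis a1 : theta_pow 1 f 1 != 0.
Local Notation i0 := (first_index n2).
Local Notation N := (~: [set i0]).
Local Notation L := (log_theta f).
Local Notation a k := (theta_pow k f 1).
Hypothesis sreg : forall V : {set 'I_n}, V != finset.set0 -> V \subset N -> V != N ->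
  holo_near f (sprod_on s V) /\ f (sprod_on s V) != 0.

(** Starting with [B], with [[set i0]] and then [B], or with [i0 |: B] contributes [- a #|B|] times
    [chainW], [a 1 * L #|B| x] times [chainP], and [- a #|B|.+1] times [chainP]. Writing [chainW]
    through [chainR] gathers the singular factors in the bracket. *)
Definition Phi_term (B : {set 'I_n}) (x : Cplx R) : Cplx R :=
  - a #|B| * chainR f s n2 B x +
  (a #|B| * (L 1 x^-1 * chainQ f s n2 B x) + a 1 * (L #|B| x * chainP f s n2 B x)) -
  a #|B|.+1 * chainP f s n2 B x.

Lemma Phi_sumE x : Phi f (tpath s x) =
  \sum_(B : {set 'I_n} | (B != finset.set0) && (B \subset N)) Phi_term B x.
Proof.
have i0n : i0 \notin finset.set0 by rewrite inE.
rewrite Phi_chains ?(ltnW n2) // chainsE ?finset.sub0set // (_ : (finset.set0 == _) = false); last first.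
  by apply/negbTE/eqP => /setP /(_ i0); rewrite !inE.
rewrite add0r (sum_split_point _ i0n) /weight eqxx cards1 !finset.set0U.
have -> : chains (weight f (tpath s x)) finset.setT [set i0] =
    \sum_(B : {set 'I_n} | (B != finset.set0) && (B \subset N)) - L #|B| x * chainP f s n2 B x.
  have := @chainPE R f n s n2 finset.set0 x (finset.sub0set _).
  rewrite /chainP finset.setU0 => ->; rewrite (_ : (finset.set0 == N) = false) ?add0r; last first.
    by apply/negbTE/eqP => /setP /(_ (last_index n2)); rewrite last_index_tail inE.
  rewrite finset.setD0; apply: eq_bigr => B _.
  by rewrite finset.set0U /tprod big_set0 mulr1.
rewrite finset.setD0 mulr_sumr -big_split /=; apply: eq_bigr => B /andP[_ sB].
rewrite !finset.set0U cardsU1 (_ : i0 \notin B) ?add1n; last exact: sub_tail_notin.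
rewrite /Phi_term /chainR -/(chainW f s B x) -/(chainP f s n2 B x).
have alg (K : comNzRingType) (u v w p q h k b : K) : - u * w + - v * p + - b * (- k * p) =
   - u * (w + h * q) + (u * (h * q) + b * (k * p)) - v * p by ring.
exact: alg.
Qed.

Lemma theta_pow_cdiff1 k : cdiff (theta_pow k f) 1 (a k.+1).
Proof.
have -> : a k.+1 = 1 * derive1 (theta_pow k f) 1 by exact: erefl.
by rewrite mul1r; exact: theta_pow_cdiff.
Qed.

Lemma Phi_term_cvg0 B : B != finset.set0 -> B \subset N ->
  (Phi_term B x @[x --> (1 : Cplx R)^'] --> (0 : Cplx R))%classic.
Proof.
move=> B0 sB; have [dp [dq [dP dQ PQ cR E]]] := chain_regularP s0 sprod sreg B0 sB.
set m := #|B|; set P := chainP f s n2 B in dP PQ *; set Q := chainQ f s n2 B in dQ PQ *.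
set r := chainR f s n2 B in cR E *.
(* [M / f] is the bracket of [Phi_term] once [L 1 x^-1] is replaced by [- L 1 x]. *)
pose M x := - a m * (theta_pow 1 f x * Q x) + a 1 * (theta_pow m f x * P x).
have dM : cdiff M 1 (a 1 * (a m.+1 * P 1 + a m * (dp - dq))).
  have D := cdiffD (cdiffM (cdiff_cst (- a m) 1) (cdiffM (theta_pow_cdiff1 1) dQ))
    (cdiffM (cdiff_cst (a 1) 1) (cdiffM (theta_pow_cdiff1 m) dP)).
  (* The derivative of [theta_pow 1 f] at 1 is [theta_pow 2 f 1]; its vanishing removes the term
     where [Q] is not differentiated. *)
  move: D; rewrite theta2_at1 // -PQ.
  have alg (K : comNzRingType) (u b c p d e z : K) :
    - u * (b * e + p * 0) + z * 0 + (b * (u * d + p * c) + (u * p) * 0) =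
    b * (c * p + u * (d - e)) by ring.
  by rewrite alg.
have M1 : M 1 = 0.
  rewrite /M PQ; have alg (K : comNzRingType) (u b q : K) : - u * (b * q) + b * (u * q) = 0 by ring.
  exact: alg.
have lim : (M x / f x @[x --> (1 : Cplx R)^'] --> a m.+1 * P 1 + a m * (dp - dq))%classic.
  have alg (K : fieldType) (b u : K) : b != 0 -> u = b * u / b by move=> b0; rewrite mulrC mulKf.
  rewrite [X in (_ --> X)%classic](alg _ (a 1) _ a1).
  exact: lhopital_simple_zero M1 f1 dM (theta_pow_cdiff1 0) a1.
have at1 (g : Cplx R -> Cplx R) : {for 1, continuous g} -> (g x @[x --> (1 : Cplx R)^'] --> g 1)%classic.
  by move=> cg; apply: cvg_within_filter; exact: cg.
have cst (k : Cplx R) : ((fun=> k) x @[x --> (1 : Cplx R)^'] --> k)%classic by exact: cvg_cst.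
have C : (- a m * r x + M x / f x - a m.+1 * P x @[x --> (1 : Cplx R)^'] -->
    - a m * r 1 + (a m.+1 * P 1 + a m * (dp - dq)) - a m.+1 * P 1)%classic.
  apply: cvgB; last exact: (cvgM (cst _) (at1 P (cdiff_continuous dP))).
  exact: (cvgD (cvgM (cst _) (at1 r cR)) lim).
have l0 : - a m * r 1 + (a m.+1 * P 1 + a m * (dp - dq)) - a m.+1 * P 1 = 0.
  have alg (K : comNzRingType) (u v w : K) : - u * v + (w + u * v) - w = 0 by ring.
  by rewrite E; exact: alg.
rewrite l0 in C; apply: (cvg_trans _ C); apply: near_eq_cvg.
have odd1 : (\forall x \near (1 : Cplx R)^', log_theta f 1 x^-1 = - log_theta f 1 x)%classic.
  by apply: cvg_within; exact: log_theta1_odd.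
apply: filterS odd1 => x O.
rewrite /Phi_term -/m -/P -/Q -/r O /M.
have alg (K : fieldType) (u v b h k q p y : K) :
    u + (- b * (h * q) + k * (v * p)) / y = u + (b * (- (h / y) * q) + k * (v / y * p)).
  by ring.
by rewrite alg.
Qed.

End Limit.

Theorem theorem11p3 (R : realType) (f : Cplx R -> Cplx R) (n : nat) :
  meromorphic_Cstar f ->
  holo_near f 1 ->
  (forall x : Cplx R, x != 0 -> holo_near f x -> holo_near f x^-1 ->
     f x^-1 = - f x) ->
  f 1 = 0 ->
  theta_pow 1 f 1 != 0 ->
  (2 <= n)%N ->
  forall s : 'I_n -> Cplx R,
    (forall j : 'I_n, val j = 0%N -> s j = 1) ->
    \prod_(j < n) s j = 1 ->
    (forall T : {set 'I_n},
       T != finset.set0 -> (forall j, j \in T -> (0 < val j)%N) ->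
       T != [set j : 'I_n | (0 < val j)%N] ->
       holo_near f (\prod_(j in T) s j) /\ f (\prod_(j in T) s j) != 0) ->
    (Phi f (tpath s x) @[x --> (1 : Cplx R)^'] --> (0 : Cplx R))%classic.
Proof.
move=> _ hf fodd f1 a1 n2 s s0 sprod sreg.
have sreg' (V : {set 'I_n}) : V != finset.set0 -> V \subset ~: [set first_index n2] ->
    V != ~: [set first_index n2] -> holo_near f (sprod_on s V) /\ f (sprod_on s V) != 0.
  move=> V0 /fintype.subsetP sV VN; apply: sreg => //; last by rewrite tail_indices.
  by move=> j /sV; rewrite !inE -val_eqE lt0n.
have -> : (fun x => Phi f (tpath s x)) = (fun x => \sum_(B : {set 'I_n} |
    (B != finset.set0) && (B \subset ~: [set first_index n2])) Phi_term f s n2 B x).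
  by apply/funext => x; exact: Phi_sumE.
rewrite [X in (_ --> X)%classic](_ : 0 = \sum_(B : {set 'I_n} |
    (B != finset.set0) && (B \subset ~: [set first_index n2])) 0); last by rewrite big1.
apply: cvgC_sum => B /andP[B0 sB]; exact: Phi_term_cvg0.
Qed.
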